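(* Let $n\geq 2$. If $\Psi\colon\mathrm{Conv}_{\mathrm c}(\mathbb{R}^n)\to[-\infty,\infty]$ is a lower semicontinuous, convex functional on $\mathrm{Conv}_{\mathrm c}(\mathbb{R}^n)$ that is invariant under rotations, then $$\Psi(\psi)\geq \Psi(\psi_{\mathrm{rot}})$$ for every $\psi\in\mathrm{Conv}_{\mathrm c}(\mathbb{R}^n)$. For $n=1$, the same inequality holds for every $\psi\in\mathrm{Conv}_{\mathrm c}(\mathbb{R})$ if $\Psi\colon\mathrm{Conv}_{\mathrm c}(\mathbb{R})\to[-\infty,\infty]$ is assumed to be convex and invariant under reflections.
   Context: $\mathrm{Conv}_{\mathrm c}(\mathbb{R}^n)$ is the set of convex functions $\psi\colon\mathbb{R}^n\to(-\infty,\infty]$ that are proper ($\psi\not\equiv\infty$), lower semicontinuous, and coercive ($\lim_{|x|\to\infty}\psi(x)=\infty$). Epi-sum (infimal convolution): $(\psi_1\,\square\,\psi_2)(x)=\inf_{y\in\mathbb{R}^n}(\psi_1(x-y)+\psi_2(y))$. Epi-multiplication: $(\lambda\cdot_{\mathrm e}\psi)(x)=\lambda\psi(x/\lambda)$ for $\lambda>0$. Convention: a functional ''with values in $[-\infty,\infty]$'' takes values either in $(-\infty,\infty]$ or in $[-\infty,\infty)$ (it never attains both $-\infty$ and $\infty$). $\Psi$ is convex if $\Psi\big((\lambda\cdot_{\mathrm e}\psi_1)\,\square\,((1-\lambda)\cdot_{\mathrm e}\psi_2)\big)\le \lambda\Psi(\psi_1)+(1-\lambda)\Psi(\psi_2)$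 for all $\psi_1,\psi_2\in\mathrm{Conv}_{\mathrm c}(\mathbb{R}^n)$ and $\lambda\in(0,1)$. $\Psi$ is invariant under rotations if $\Psi(\psi\circ\vartheta^{-1})=\Psi(\psi)$ for all $\psi$ and all $\vartheta\in \mathrm{SO}(n)$; for $n=1$, it is invariant under reflections if this holds for all $\vartheta\in \mathrm{O}(1)=\{\pm1\}$. Semicontinuity is with respect to the topology of epi-convergence: $\psi_j$ epi-converges to $\psi$ if for every $x\in\mathbb{R}^n$, (i) $\psi(x)\le\liminf_j\psi_j(x_j)$ for every sequence $x_j\to x$, and (ii) $\psi(x)=\lim_j\psi_j(x_j)$ for some sequence $x_j\to x$. Legendre--Fenchel transform: $\mathcal{L}\psi(x)=\sup_{y\in\mathbb{R}^n}(\langle x,y\rangle-\psi(y))$. Rotational epi-symmetrization: for $n\ge2$ and $\psi\in\mathrm{Conv}_{\mathrm c}(\mathbb{R}^n)$, $\psi_{\mathrm{rot}}$ is the unique function in $\mathrm{Conv}_{\mathrm c}(\mathbb{R}^n)$ with $\mathcal{L}\psi_{\mathrm{rot}}(x)=\int_{\mathrm{SO}(n)}\mathcal{L}\psi(\vartheta^{-1}x)\,\mathrm{d}\vartheta$ for all $x\in\mathbb{R}^n$, where integration is with respect to the Haar probability measure on $\mathrm{SO}(n)$. For $n=1$, $\psi_{\mathrm{rot}}=\tfrac12\cdot_{\mathrm e}(\psi\,\square\,\psi^-)$ with $\psi^-(x)=\psi(-x)$. *)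

(* Defs.v *)
From HB Require Import structures.
From mathcomp Require Import all_boot all_order all_algebra.
From mathcomp Require Import all_classical all_reals all_analysis.

Set Implicit Arguments.
Unset Strict Implicit.
Unset Printing Implicit Defensive.

Import Order.TTheory GRing.Theory Num.Theory.
Import numFieldNormedType.Exports.

Local Open Scope classical_set_scope.
Local Open Scope ring_scope.

Definition dot (R : realType) (n : nat) (x y : 'cV[R]_n) : R :=
  \sum_(i < n) x i 0 * y i 0.

(* The norm of the library on matrices is the sup norm. *)
Definition enorm (R : realType) (n : nat) (x : 'cV[R]_n) : R :=
  Num.sqrt (dot x x).

Definition convex_efun (R : realType) (n : nat) (psi : 'cV[R]_n -> \bar R) :=
  forall (x y : 'cV[R]_n) (t : R), 0 < t -> t < 1 ->
    (psi (t *: x + (1 - t) *: y)%R <= t%:E * psi x + (1 - t)%R%:E * psi y)%E.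

Definition proper (R : realType) (n : nat) (psi : 'cV[R]_n -> \bar R) :=
  exists x, (psi x < +oo)%E.

Definition coercive (R : realType) (n : nat) (psi : 'cV[R]_n -> \bar R) :=
  forall M : R, exists r : R, forall x, r < enorm x -> (M%:E <= psi x)%E.

Definition Conv_c (R : realType) (n : nat) : set ('cV[R]_n -> \bar R) :=
  [set psi | [/\ forall x, (-oo < psi x)%E, convex_efun psi, proper psi,
                 lower_semicontinuous psi & coercive psi]].

Definition epi_sum (R : realType) (n : nat) (psi1 psi2 : 'cV[R]_n -> \bar R) :
    'cV[R]_n -> \bar R :=
  fun x => ereal_inf (range (fun y => psi1 (x - y)%R + psi2 y)%E).

(* Only meaningful for lam > 0. *)
Definition epi_mul (R : realType) (n : nat) (lam : R)
    (psi : 'cV[R]_n -> \bar R) : 'cV[R]_n -> \bar R :=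
  fun x => (lam%:E * psi (lam^-1 *: x)%R)%E.

Definition epi_cvg (R : realType) (n : nat)
    (psi_ : nat -> 'cV[R]_n -> \bar R) (psi : 'cV[R]_n -> \bar R) :=
  forall x : 'cV[R]_n,
    (forall x_ : nat -> 'cV[R]_n, x_ @ \oo --> x ->
       (psi x <= limn_einf (fun j => psi_ j (x_ j)))%E) /\
    (exists2 x_ : nat -> 'cV[R]_n, x_ @ \oo --> x &
       (fun j => psi_ j (x_ j)) @ \oo --> psi x).

Definition legendre (R : realType) (n : nat) (psi : 'cV[R]_n -> \bar R) :
    'cV[R]_n -> \bar R :=
  fun x => ereal_sup (range (fun y => (dot x y)%:E - psi y)%E).

Definition Ogrp (R : realType) (n : nat) : set 'M[R]_n :=
  [set theta | theta^T *m theta = 1%:M].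

Definition SOgrp (R : realType) (n : nat) : set 'M[R]_n :=
  [set theta | Ogrp theta /\ \det theta = 1].

(* The functionals below are total on functions 'cV[R]_n -> \bar R, but all
   conditions on them only concern their values on Conv_c, which is closed
   under the operations involved; so they are functionals on Conv_c. *)

Definition one_sided_infinite (R : realType) (n : nat)
    (Psi : ('cV[R]_n -> \bar R) -> \bar R) :=
  (forall psi, Conv_c psi -> (-oo < Psi psi)%E) \/
  (forall psi, Conv_c psi -> (Psi psi < +oo)%E).

Definition epi_lsc (R : realType) (n : nat)
    (Psi : ('cV[R]_n -> \bar R) -> \bar R) :=
  forall (psi_ : nat -> 'cV[R]_n -> \bar R) (psi : 'cV[R]_n -> \bar R),
    (forall j, Conv_c (psi_ j)) -> Conv_c psi -> epi_cvg psi_ psi ->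
    (Psi psi <= limn_einf (fun j => Psi (psi_ j)))%E.

Definition epi_convex (R : realType) (n : nat)
    (Psi : ('cV[R]_n -> \bar R) -> \bar R) :=
  forall (psi1 psi2 : 'cV[R]_n -> \bar R) (lam : R),
    Conv_c psi1 -> Conv_c psi2 -> 0 < lam -> lam < 1 ->
    (Psi (epi_sum (epi_mul lam psi1) (epi_mul (1 - lam)%R psi2)) <=
       lam%:E * Psi psi1 + (1 - lam)%R%:E * Psi psi2)%E.

Definition invariant_under (R : realType) (n : nat) (G : set 'M[R]_n)
    (Psi : ('cV[R]_n -> \bar R) -> \bar R) :=
  forall (psi : 'cV[R]_n -> \bar R) (theta : 'M[R]_n), Conv_c psi -> G theta ->
    Psi (fun x => psi (invmx theta *m x)) = Psi psi.

Definition borelM (R : realType) (n : nat) :=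
  g_sigma_algebraType (@open 'M[R]_n).

(* The Haar probability measure of SO(n), seen as a Borel probability measure
   on all matrices that is carried by SO(n). *)
Definition haar_SO (R : realType) (n : nat)
    (mu : probability (borelM R n) R) :=
  mu (@SOgrp R n) = 1%E /\
  forall (theta : 'M[R]_n) (A : set (borelM R n)), SOgrp theta -> measurable A ->
    mu [set eta : 'M[R]_n | A (theta *m eta)] = mu A.

(* "psi' is psi_rot" for n >= 2. *)
Definition is_rot (R : realType) (n : nat) (mu : probability (borelM R n) R)
    (psi psi' : 'cV[R]_n -> \bar R) :=
  Conv_c psi' /\
  forall x : 'cV[R]_n, legendre psi' x =
    (\int[mu]_(theta in @SOgrp R n) legendre psi (invmx theta *m x)%R)%E.

Definition rot1 (R : realType) (psi : 'cV[R]_1 -> \bar R) :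
    'cV[R]_1 -> \bar R :=
  epi_mul 2^-1 (epi_sum psi (fun x => psi (- x))).

(* Main.v *)
Require Import Defs.
From mathcomp Require Import all_boot all_order all_algebra.
From mathcomp Require Import all_classical all_reals all_analysis.
From mathcomp Require Import measurable_realfun ring lra.

(** Write f for the Legendre transform of psi and F for that of psi_rot, so that
    F is the mean of the functions f o theta^-1 over SO(n).  If psi_rot were an
    epi-convex combination of finitely many rotated copies psi o theta_i^-1, with
    weights w_i, then convexity and invariance would give
    Psi psi_rot <= sum_i w_i Psi (psi o theta_i^-1) = Psi psi.
    In general, cut SO(n) into finitely many small cells, let w_i be the mass of
    the i-th cell and theta_i one of its points.  The combination phi that belongs
    to this partition satisfies Psi phi <= Psi psi ([finite_jensen]) and has the
    Legendre transform g = sum_i w_i f o theta_i^-1, a Riemann sum for F.  Because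
    Psi is lower semicontinuous, it remains to see that phi epi-converges to
    psi_rot when the partition is refined.

    Since psi grows at least linearly, f is bounded above by some C on some ball
    around 0.  Given t < 1 and two rotations A and B that are close to each other,
    A^-1 (t p) = t B^-1 p + (1 - t) w with w in that ball, hence
      f (A^-1 (t p)) <= t f (B^-1 p) + (1 - t) C    ([legendre_perturb]).
    Averaging this over the cells, with A in the cell of B = theta_i or the other
    way round, yields
      F (t p) <= t g p + (1 - t) C   and   g (t p) <= t F p + (1 - t) C
    for all p in a bounded set once the cells are small enough
    ([rotation_mean_approx]).  These two inequalities make sense, and suffice,
    even though f and F may be infinite and need not be continuous.

    They imply epi-convergence ([epi_cvg_of_legendre]).  As psi_rot x is the
    supremum of <p, x> - F p ([biconjugate]), the second one with t -> 1 bounds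
    phi from below near x.  For a recovery sequence, let z minimize
    phi z + k / 2 |z - x|^2.  Then p = k (x - z) is a subgradient of phi at z
    ([prox]), that is, g p <= <p, z> - phi z, and the first one gives
      t (phi z + k |z - x|^2) <= psi_rot x + (1 - t) C,
    so z is close to x and phi z is almost at most psi_rot x when k is large and
    t is close to 1.

    For n = 1, rot1 psi is itself the epi-convex combination of psi and of its
    reflection with weights 1/2. *)

Set Implicit Arguments.
Unset Strict Implicit.
Unset Printing Implicit Defensive.

Import Order.TTheory GRing.Theory Num.Theory.
Import numFieldNormedType.Exports.

Local Open Scope classical_set_scope.
Local Open Scope ring_scope.

(** * The scalar product and the sup norm *)

Section Vectors.
Variables (R : realType) (n : nat).
Implicit Types (x y z : 'cV[R]_n) (t r : R).

Lemma dotC x y : dot x y = dot y x.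
Proof. by apply: eq_bigr => i _; rewrite mulrC. Qed.

Lemma dotDl x y z : dot (x + y) z = dot x z + dot y z.
Proof. by rewrite -big_split; apply: eq_bigr => i _; rewrite !mxE mulrDl. Qed.

Lemma dotZl t x z : dot (t *: x) z = t * dot x z.
Proof. by rewrite /dot big_distrr; apply: eq_bigr => i _; rewrite !mxE /= mulrA. Qed.

Lemma dotNl x z : dot (- x) z = - dot x z.
Proof. by rewrite -scaleN1r dotZl mulN1r. Qed.

Lemma dotDr x y z : dot z (x + y) = dot z x + dot z y.
Proof. by rewrite !(dotC z) dotDl. Qed.

Lemma dotZr t x z : dot z (t *: x) = t * dot z x.
Proof. by rewrite !(dotC z) dotZl. Qed.

Lemma dotNr x z : dot z (- x) = - dot z x.
Proof. by rewrite !(dotC z) dotNl. Qed.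

Lemma dotBr x y z : dot z (x - y) = dot z x - dot z y.
Proof. by rewrite dotDr dotNr. Qed.

Definition dotE := (dotDl, dotDr, dotNl, dotNr, dotZl, dotZr).

Lemma dot_trmx (A : 'M[R]_n) x y : dot (A *m x) y = dot x (A^T *m y).
Proof.
rewrite /dot; under eq_bigr do rewrite mxE big_distrl /=.
rewrite exchange_big; apply: eq_bigr => j _; rewrite mxE big_distrr /=.
by apply: eq_bigr => i _; rewrite !mxE; ring.
Qed.

Lemma dotxx_ge0 x : 0 <= dot x x.
Proof. by apply: sumr_ge0 => i _; rewrite -expr2 sqr_ge0. Qed.

Lemma norm_coord (m k : nat) (A : 'M[R]_(m, k)) i j : `|A i j| <= `|A|.
Proof. by rewrite [leRHS]/Num.norm /= mx_normrE (le_bigmax _ _ (i, j)). Qed.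

Lemma norm_coordP (m k : nat) (A : 'M[R]_(m, k)) r : 0 <= r ->
  (forall i j, `|A i j| <= r) -> `|A| <= r.
Proof.
move=> r0 Ar; rewrite [leLHS]/Num.norm /= mx_normrE.
by apply/bigmax_leP; split => // -[].
Qed.

Lemma norm_dot x y : `|dot x y| <= n%:R * (`|x| * `|y|).
Proof.
apply: le_trans (ler_norm_sum _ _ _) _.
apply: le_trans (ler_sum _ (G := fun=> `|x| * `|y|) _) _.
  by move=> i _; rewrite normrM ler_pM// norm_coord.
by rewrite sumr_const card_ord mulr_natl.
Qed.

Lemma sqr_norm_le_dot x : `|x| ^+ 2 <= dot x x.
Proof.
suff : `|x| <= Num.sqrt (dot x x).
  by move=> h; rewrite -[leRHS](sqr_sqrtr (dotxx_ge0 x)) ler_sqr ?nnegrE ?sqrtr_ge0.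
apply: norm_coordP => [|i j]; first exact: sqrtr_ge0.
rewrite (ord1 j) -sqrtr_sqr ler_sqrt ?dotxx_ge0// /dot (bigD1 i)//= expr2 lerDl.
by apply: sumr_ge0 => k _; rewrite -expr2 sqr_ge0.
Qed.

Lemma norm_le_enorm x : `|x| <= enorm x.
Proof.
rewrite -[leLHS]ger0_norm// -sqrtr_sqr ler_sqrt ?dotxx_ge0//.
exact: sqr_norm_le_dot.
Qed.

Lemma norm_mulmx (m k : nat) (A : 'M[R]_(m, n)) (B : 'M[R]_(n, k)) :
  `|A *m B| <= n%:R * (`|A| * `|B|).
Proof.
apply: norm_coordP => [|i j]; first by rewrite mulr_ge0// mulr_ge0.
rewrite mxE; apply: le_trans (ler_norm_sum _ _ _) _.
apply: le_trans (ler_sum _ (G := fun=> `|A| * `|B|) _) _.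
  by move=> l _; rewrite normrM ler_pM// norm_coord.
by rewrite sumr_const card_ord mulr_natl.
Qed.

Lemma norm_trmx (m k : nat) (A : 'M[R]_(m, k)) : `|A^T| = `|A|.
Proof.
by apply/eqP; rewrite eq_le; apply/andP; split; apply: norm_coordP => // i j;
  rewrite ?mxE ?norm_coord//; have := norm_coord A^T j i; rewrite mxE.
Qed.

(** The two norms are equivalent, so that coercivity can be tested with the sup norm,
    the one that defines the topology of matrices. *)
Lemma coerciveP (psi : 'cV[R]_n -> \bar R) :
  coercive psi <-> forall M : R, exists r : R, forall x, r < `|x| -> (M%:E <= psi x)%E.
Proof.
split=> cpsi M; have [r hr] := cpsi M.
  by exists r => x rx; apply: hr; apply: lt_le_trans rx (norm_le_enorm x).
exists (Num.sqrt (n%:R * (r * r))) => x; rewrite ltNge => rx; apply: hr.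
rewrite ltNge; apply: contra rx => xr.
rewrite ler_sqrt; last by rewrite mulr_ge0// -expr2 sqr_ge0.
apply: le_trans (ler_norm _) _; apply: le_trans (norm_dot x x) _.
by rewrite ler_wpM2l// ler_pM.
Qed.

Lemma continuous_dotl y : continuous (fun x => dot x y).
Proof.
apply: continuous_big => [|i _ x]; first exact: add_continuous.
apply: (@continuousM _ _ (fun x : 'cV[R]_n => x i 0) (cst (y i 0))).
  exact: coord_continuous.
exact: cst_continuous.
Qed.

Lemma continuous_mulmx_coord (x : 'cV[R]_n) (i : 'I_n) :
  continuous (fun A : 'M[R]_n => (A^T *m x) i 0).
Proof.
under eq_fun do rewrite mxE.
apply: continuous_big => [|j _ A]; first exact: add_continuous.
apply: (@continuousM _ _ (fun A : 'M[R]_n => A^T i j) (cst (x j 0))).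
  have -> : (fun A : 'M[R]_n => A^T i j) = fun A => A j i.
    by apply/funext => B; rewrite mxE.
  exact: coord_continuous.
exact: cst_continuous.
Qed.

Lemma continuous_dot_trmx x y : continuous (fun A : 'M[R]_n => dot (A^T *m x) y).
Proof.
apply: continuous_big => [|j _ A]; first exact: add_continuous.
apply: (@continuousM _ _ (fun A : 'M[R]_n => (A^T *m x) j 0) (cst (y j 0))).
  exact: continuous_mulmx_coord.
exact: cst_continuous.
Qed.

Lemma compact_ball r : compact [set x : 'cV[R]_n | `|x| <= r].
Proof.
pose K := [set u : 'rV[R]_n | `|u| <= r].
have cK : compact K.
  apply: bounded_closed_compact.
    exists r; split; first exact: num_real.
    by move=> s rs u /= Ku; apply: le_trans Ku (ltW rs).
  have -> : K = Num.norm @^-1` [set t : R | t <= r] by [].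
  by apply: closed_comp => [u _|]; [exact: norm_continuous|exact: closed_le].
have -> : [set x : 'cV[R]_n | `|x| <= r] = (fun u : 'rV[R]_n => u^T) @` K.
  apply/seteqP; split => [x xr|_ [u Ku <-]] /=; last by rewrite norm_trmx.
  by exists x^T; rewrite ?trmxK// /K /= norm_trmx.
apply: continuous_compact => //; apply: continuous_subspaceT => u.
move=> U /nbhs_ballP[e e0 eU]; apply/nbhs_ballP; exists e => // v.
rewrite -ball_normE /= => uv; apply: eU; rewrite -ball_normE /=.
have -> : u^T - v^T = (u - v)^T by rewrite linearB.
by rewrite norm_trmx.
Qed.

End Vectors.

(** * Real and extended real numbers *)

(** The passage t -> 0 in a difference quotient. *)
Lemma ge0_of_affine_ge0 (R : realType) (c d : R) :
  (forall t, 0 < t -> t < 1 -> 0 <= c + t * d) -> 0 <= c.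
Proof.
move=> h; rewrite leNgt; apply/negP => c0.
(* With this t, the term t d is at most half of - c. *)
pose t := - c / (2 * (`|d| + `|c|)).
have nc : `|c| = - c by rewrite ltr0_norm.
have D0 : 0 < 2 * (`|d| + `|c|) by have := normr_ge0 d; lra.
have t0 : 0 < t by rewrite divr_gt0//; lra.
have t1 : t < 1 by rewrite /t ltr_pdivrMr//; have := normr_ge0 d; lra.
have tD : t * (2 * (`|d| + `|c|)) = - c by rewrite mulfVK// gt_eqF.
have tc := mulr_ge0 (ltW t0) (normr_ge0 c).
have td : t * d <= t * `|d| by rewrite ler_pM2l// ler_norm.
by have := h _ t0 t1; lra.
Qed.

(** For t close to 1, the gap between a and s absorbs the term (1 - t) D. *)
Lemma convex_comb_gt (R : realType) (a s D : R) : a < s ->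
  exists t, [/\ 0 < t, t < 1 & a < t * s + (1 - t) * D].
Proof.
move=> sa; pose e := (s - a) / (2 * ((s - a) + `|s - D|)).
have d0 := normr_ge0 (s - D).
have e0 : 0 < e by rewrite divr_gt0//; lra.
have e1 : e <= 2^-1 by rewrite /e ler_pdivrMr; lra.
exists (1 - e); split; [lra|lra|].
have eE : e * (2 * ((s - a) + `|s - D|)) = s - a by rewrite mulfVK// gt_eqF//; lra.
have h1 : e * (s - D) <= e * `|s - D| by rewrite ler_pM2l// ler_norm.
have h2 : 0 <= e * (s - a) by rewrite mulr_ge0//; lra.
lra.
Qed.

Lemma ereal_between (R : realType) (a b : \bar R) : (a < b)%E ->
  exists r : R, (a < r%:E)%E /\ (r%:E < b)%E.
Proof.
case: a => [a||] //; case: b => [b||] //=.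
- rewrite lte_fin => ab; exists ((a + b) / 2); rewrite !lte_fin; lra.
- by move=> _; exists (a + 1); rewrite lte_fin ltry; split => //; lra.
- by move=> _; exists (b - 1); rewrite lte_fin ltNyr; split => //; lra.
- by move=> _; exists 0; rewrite ltNyr ltry.
Qed.

Lemma lee_lt_real (R : realType) (a b : \bar R) :
  (forall r : R, (r%:E < a)%E -> (r%:E <= b)%E) -> (a <= b)%E.
Proof.
move=> ab; rewrite leNgt; apply/negP => /ereal_between[r [br ra]].
by have := lt_le_trans br (ab _ ra); rewrite ltxx.
Qed.

Lemma ereal_eq_ub (R : realType) (a b : \bar R) :
  (forall c : R, (a <= c%:E)%E <-> (b <= c%:E)%E) -> a = b.
Proof.
move=> ab; apply/eqP; rewrite eq_le; apply/andP; split;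
  rewrite leNgt; apply/negP => /ereal_between[r [r1 r2]].
- by have := lt_le_trans r2 ((ab r).2 (ltW r1)); rewrite ltxx.
- by have := lt_le_trans r2 ((ab r).1 (ltW r1)); rewrite ltxx.
Qed.

Lemma lte_split (R : realType) (a : R) (b1 b2 : \bar R) :
  (-oo < b1)%E -> (-oo < b2)%E -> (a%:E < b1 + b2)%E ->
  exists c1 c2 : R, [/\ (c1%:E < b1)%E, (c2%:E < b2)%E & a < c1 + c2].
Proof.
case: b1 => [b1||] //; case: b2 => [b2||] //= _ _ ab.
- exists (b1 - (b1 + b2 - a) / 3), (b2 - (b1 + b2 - a) / 3).
  by move: ab; rewrite -EFinD !lte_fin => ab; split; lra.
- by exists (b1 - 1), (a - b1 + 2); rewrite lte_fin ltry; split => //; lra.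
- by exists (a - b2 + 2), (b2 - 1); rewrite lte_fin ltry; split => //; lra.
- by exists (a + 1), 0; rewrite !ltry; split => //; lra.
Qed.

Lemma lte_scale (R : realType) (l a : R) (b : \bar R) : 0 < l ->
  (a%:E < l%:E * b)%E = ((l^-1 * a)%:E < b)%E.
Proof.
move=> l0; case: b => [b||].
- by rewrite -EFinM !lte_fin ltr_pdivrMl.
- by rewrite gt0_muley ?lte_fin// !ltry.
- by rewrite gt0_muleNy ?lte_fin.
Qed.

Lemma lee_scale (R : realType) (l a : R) (b : \bar R) : 0 < l ->
  (a%:E <= l%:E * b)%E = ((l^-1 * a)%:E <= b)%E.
Proof.
move=> l0; case: b => [b||].
- by rewrite -EFinM !lee_fin ler_pdivrMl.
- by rewrite gt0_muley ?lte_fin// !leey.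
- by rewrite gt0_muleNy ?lte_fin.
Qed.

Lemma scale_lee (R : realType) (l a : R) (b : \bar R) : 0 < l ->
  (l%:E * b <= a%:E)%E = (b <= (l^-1 * a)%:E)%E.
Proof. by move=> l0; rewrite !leNgt lte_scale. Qed.

Lemma scale_adde (R : realType) (l : R) (x y : \bar R) :
  0 <= l -> (l%:E * (x + y) = l%:E * x + l%:E * y)%E.
Proof.
rewrite le_eqVlt => /predU1P[<-|l0]; first by rewrite !mul0e adde0.
case: x => [x||]; case: y => [y||];
  rewrite ?(gt0_muley (_ : 0 < _%:E)%E) ?(gt0_muleNy (_ : 0 < _%:E)%E) ?lte_fin//.
by rewrite -EFinD -!EFinM -EFinD mulrDr.
Qed.

Lemma scale_sume (R : realType) (I : Type) (s : seq I) (l : R) (a : I -> \bar R) :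
  0 <= l -> (l%:E * \sum_(i <- s) a i = \sum_(i <- s) l%:E * a i)%E.
Proof.
move=> l0; apply: (big_morph (fun x => l%:E * x)%E); last by rewrite mule0.
by move=> x y; exact: scale_adde.
Qed.

Lemma affine_sume (R : realType) (I : finType) (w : I -> R) (a : I -> \bar R) (t b : R) :
  (forall i, 0 <= w i) -> \sum_i w i = 1 -> 0 <= t ->
  (\sum_i (w i)%:E * (t%:E * a i + b%:E) = t%:E * (\sum_i (w i)%:E * a i) + b%:E)%E.
Proof.
move=> w0 w1 t0; rewrite scale_sume//.
under eq_bigr do rewrite scale_adde//.
rewrite big_split /=; congr (_ + _)%E; first by apply: eq_bigr => i _; rewrite muleCA.
by under eq_bigr do rewrite -EFinM; rewrite sumEFin -mulr_suml w1 mul1r.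
Qed.

Lemma convex_comb_le (R : realType) (t : R) (a b M : \bar R) : 0 < t -> t < 1 ->
  (a <= M)%E -> (b <= M)%E -> (t%:E * a + (1 - t)%:E * b <= M)%E.
Proof.
move=> t0 t1 aM bM; have t1' : 0 < 1 - t by lra.
have h1 : (t%:E * a <= t%:E * M)%E by apply: lee_wpmul2l => //; rewrite lee_fin ltW.
have h2 : ((1 - t)%:E * b <= (1 - t)%:E * M)%E by apply: lee_wpmul2l => //; rewrite lee_fin ltW.
apply: le_trans (leeD h1 h2) _.
case: M {aM bM h1 h2} => [m||]; last 2 first.
- by rewrite leey.
- by rewrite !gt0_muleNy ?lte_fin.
by rewrite -!EFinM -EFinD lee_fin; lra.
Qed.

(** A value may be infinite where its weight vanishes; the convention 0 * +oo = 0
    then makes it harmless. *)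
Section WeightedSums.
Variables (R : realType) (I : finType) (w : I -> R) (a : I -> \bar R).
Hypothesis w_ge0 : forall i, 0 <= w i.
Hypothesis a_gtNy : forall i, (-oo < a i)%E.

Lemma weighted_sum_fine : (forall i, 0 < w i -> (a i < +oo)%E) ->
  (\sum_i (w i)%:E * a i = (\sum_i w i * fine (a i))%:E)%E.
Proof.
move=> afin; rewrite -sumEFin; apply: eq_bigr => i _.
have := w_ge0 i; rewrite le_eqVlt => /predU1P[<-|/afin]; first by rewrite mul0e mul0r.
by case: (a i) (a_gtNy i) => [b| |].
Qed.

Lemma weighted_sum_infty i : 0 < w i -> a i = +oo%E -> (\sum_i (w i)%:E * a i = +oo)%E.
Proof.
move=> wi ai; rewrite (bigD1 i)//= ai gt0_muley ?lte_fin// addye//.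
rewrite gt_eqF//; elim/big_ind: _ => //.
  by move=> x y; rewrite !ltNye adde_eq_ninfty negb_or => -> ->.
move=> k _; have := w_ge0 k; rewrite le_eqVlt => /predU1P[<-|wk]; first by rewrite mul0e.
case: (a k) (a_gtNy k) => [b| |] // _; first by rewrite -EFinM ltNyr.
by rewrite gt0_muley ?lte_fin.
Qed.

(** An infinite value of positive weight can be replaced by arbitrarily large real
    numbers, hence real minorants determine the sum. *)
Lemma weighted_sum_le (b : \bar R) :
  (forall c : I -> R, (forall i, ((c i)%:E <= a i)%E) -> ((\sum_i w i * c i)%:E <= b)%E) ->
  (\sum_i (w i)%:E * a i <= b)%E.
Proof.
move=> H; have fa i : ((fine (a i))%:E <= a i)%E.
  by case: (a i) (a_gtNy i) => [c| |]; rewrite ?leey.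
have [afin|/existsNP[i /not_implyP[wi /negP]]] :=
    pselect (forall i, 0 < w i -> (a i < +oo)%E).
  by rewrite weighted_sum_fine//; exact: H.
rewrite -leNgt leye_eq => /eqP ai.
rewrite (weighted_sum_infty wi ai) leye_eq; apply/eqP/eq_infty => x.
pose s := \sum_(k | k != i) w k * fine (a k).
(* This choice makes the weighted sum of c equal to x. *)
pose c k := if k == i then (x - s) / w i else fine (a k).
have /H : forall k, ((c k)%:E <= a k)%E.
  by move=> k; rewrite /c; case: eqP => [->|_]; rewrite ?ai ?leey.
rewrite (bigD1 i)//= {1}/c eqxx mulrCA divff ?gt_eqF// mulr1.
have -> : \sum_(k | k != i) w k * c k = s.
  by apply: eq_bigr => k /negPf ki; rewrite /c ki.
by rewrite subrK.
Qed.

End WeightedSums.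

Lemma limn_einf_ge (R : realType) (u : nat -> \bar R) (l : \bar R) :
  (forall a : R, (a%:E < l)%E -> \forall j \near \oo, (a%:E <= u j)%E) ->
  (l <= limn_einf u)%E.
Proof.
move=> H; apply: lee_lt_real => a /H[N _ HN].
rewrite limn_einf_lim (cvg_lim _ (@cvg_einfs_sup _ u))//.
apply: (@le_trans _ _ (einfs u N)); last by apply: ereal_sup_ubound; exists N.
by apply: le_ereal_inf_tmp => _ [j /= Nj <-]; exact: HN.
Qed.

(** * Lower semicontinuity and minimizers *)

Lemma lsc_comp (R : realType) (X Y : topologicalType) (h : X -> Y)
  (f : Y -> \bar R) : continuous h -> lower_semicontinuous f ->
  lower_semicontinuous (f \o h).
Proof.
move=> ch lf x a /lf[V hV Va]; exists (h @^-1` V); first exact: ch.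
by move=> y /Va.
Qed.

Lemma lsc_add_continuous (R : realType) (X : topologicalType) (h : X -> R)
  (f : X -> \bar R) : continuous h -> lower_semicontinuous f ->
  lower_semicontinuous (fun x => f x + (h x)%:E)%E.
Proof.
move=> ch lf x a; rewrite -lteBlDr// -EFinB => /ereal_between[b []].
rewrite lte_fin => ab /lf[V hV Vb].
have hx : nbhs x (h @^-1` [set t | a - b < t]).
  by apply: ch; apply: open_nbhs_nbhs; split => /=; [exact: open_gt|lra].
exists (V `&` (h @^-1` [set t | a - b < t])); first exact: filterI.
move=> y [/Vb by_ /= abh].
rewrite -lteBlDr// -EFinB; apply: le_lt_trans by_.
by rewrite lee_fin; lra.
Qed.

Section Minimizers.
Variables (R : realType) (n : nat).
Implicit Types (x y z : 'cV[R]_n).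

(** If no minimum were attained, the sets [g > u j], for u j values of g tending to
    the infimum, would cover the compact ball outside of which g is large; by
    compactness one of them would already contain the ball, whereas u j is itself
    a value of g. *)
Lemma exists_minimizer (g : 'cV[R]_n -> \bar R) :
  lower_semicontinuous g -> coercive g -> Defs.proper g ->
  exists z, forall x, (g z <= g x)%E.
Proof.
move=> lg /coerciveP cg [x0 gx0]; apply: contrapT => /forallNP nomin.
pose m := ereal_inf (range g).
have mlt z : (m < g z)%E.
  have /existsNP[x /negP] := nomin z; rewrite -ltNge; apply: le_lt_trans.
  by apply: ereal_inf_lbound; exists x.
have [M [mM _]] := ereal_between (mlt x0).
have [r hr] := cg M.
have [u um ulim] : {u : (\bar R)^nat | forall i, range g (u i) & u @ \oo --> m}.
  by apply: ereal_inf_seq; apply/set0P; exists (g x0), x0.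
have ult a : (m < a)%E -> \forall j \near \oo, (u j < a)%E.
  move=> ma; have : nbhs m [set y | (y < a)%E].
    by apply: open_nbhs_nbhs; split => //; exact: open_ereal_lt_ereal.
  exact: ulim.
have cK := (compact_near_coveringP _).1 (@compact_ball R n r).
have [N _ HN] : \forall j \near \oo, [set x : 'cV[R]_n | `|x| <= r] `<=` [set y | (u j < g y)%E].
  apply: cK => y _; have [a [ma ag]] := ereal_between (mlt y).
  have [V yV Va] := lg _ _ ag.
  exists (V, [set j | (u j < a%:E)%E]); first by split => //; exact: ult.
  by move=> [y' j] /= [/Va ay' uj]; exact: lt_trans ay'.
have [N' _ HN'] := ult _ mM.
pose j := maxn N N'; have [z _ gz] := um j.
have := HN' _ (leq_maxr N N'); rewrite /= -/j -gz => gzM.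
have [zr|zr] := leP `|z| r; last by have := lt_le_trans gzM (hr _ zr); rewrite ltxx.
by have := HN _ (leq_maxl N N') z zr; rewrite /= -/j -gz ltxx.
Qed.

End Minimizers.

(** * Subgradients and the Legendre transform *)

Section ConvexFunctions.
Variables (R : realType) (n : nat) (psi : 'cV[R]_n -> \bar R).
Hypothesis psiC : Conv_c psi.
Implicit Types (x y z p q : 'cV[R]_n).

Lemma Conv_c_minimizer : exists z (a : R), psi z = a%:E /\
  forall x, (a%:E <= psi x)%E.
Proof.
have [gt0 _ [x0 x0p] lpsi cpsi] := psiC.
have [z hz] := exists_minimizer lpsi cpsi (ex_intro _ x0 x0p).
have zfin : psi z \is a fin_num.
  by rewrite fin_numE gt_eqF// lt_eqF// (le_lt_trans (hz x0)).
by exists z, (fine (psi z)); rewrite fineK.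
Qed.

Lemma fenchel_young x p : ((dot p x)%:E - psi x <= legendre psi p)%E.
Proof. by apply: ereal_sup_ubound; exists x. Qed.

(** The affine minorants of psi with slope p are the upper bounds of its Legendre
    transform at p; computations with transforms reduce to this equivalence. *)
Lemma legendre_le p (c : R) : (legendre psi p <= c%:E)%E <->
  forall x, ((dot p x - c)%:E <= psi x)%E.
Proof.
have [gt0 _ _ _ _] := psiC.
have eq x : ((dot p x)%:E - psi x <= c%:E)%E = ((dot p x - c)%:E <= psi x)%E.
  case: (psi x) (gt0 x) => [b| |] //= _; first by rewrite !lee_fin; apply/idP/idP; lra.
  by rewrite leNye leey.
split=> [lc x|h].
  by rewrite -eq; apply: le_trans lc; exact: fenchel_young.
by apply: ge_ereal_sup => _ [x _ <-]; rewrite eq.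
Qed.

Lemma legendre_gtNy p : (-oo < legendre psi p)%E.
Proof.
have [z [a [za _]]] := Conv_c_minimizer.
by apply: lt_le_trans (fenchel_young z p); rewrite za -EFinB ltNyr.
Qed.

Lemma legendre_lsc (X : topologicalType) (h : X -> 'cV[R]_n) :
  (forall y, continuous (fun u : X => dot (h u) y)) ->
  lower_semicontinuous (legendre psi \o h).
Proof.
move=> ch x a /= /ereal_sup_gt[_ [y _ <-]] ay.
have lc : lower_semicontinuous (fun _ : X => - psi y)%E.
  by move=> u b bu; exists setT; [exact: filterT|].
have {}ay : (a%:E < - psi y + (dot (h x) y)%:E)%E by rewrite addeC.
have [V xV Va] := lsc_add_continuous (ch y) lc ay.
exists V => // u /Va; rewrite addeC => /lt_le_trans; apply.
exact: fenchel_young.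
Qed.

Lemma legendre_convex p q (t : R) : 0 <= t -> t <= 1 ->
  (legendre psi (t *: p + (1 - t) *: q) <=
     t%:E * legendre psi p + (1 - t)%:E * legendre psi q)%E.
Proof.
move=> t0 t1; have [gt0 _ _ _ _] := psiC.
apply: ge_ereal_sup => _ [y _ <-].
have hp := fenchel_young y p; have hq := fenchel_young y q.
apply: le_trans (leeD (lee_wpmul2l _ hp) (lee_wpmul2l _ hq)); rewrite ?lee_fin//; last lra.
case: (psi y) (gt0 y) => [b| |] //= _; last by rewrite leNye.
by rewrite -!EFinB -!EFinM -EFinD lee_fin !dotE; lra.
Qed.

(** Let z0 be a minimizer of psi, a the minimum, and suppose that psi >= a + 1
    outside the ball of radius s around z0.  By convexity on the rays from z0, psi
    grows there with slope at least 1 / s ([grow] in the proof), and slopes of size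
    smaller than that are absorbed. *)
Lemma legendre_bounded_near0 : exists (e C : R), 0 < e /\
  forall w, `|w| <= e -> (legendre psi w <= C%:E)%E.
Proof.
have [gt0 cvx _ _ /coerciveP cpsi] := psiC.
have [z0 [a [za amin]]] := Conv_c_minimizer.
have [r hr] := cpsi (a + 1).
pose s := `|r| + `|z0| + 1.
have s0 : 0 < s by rewrite /s; have := normr_ge0 r; have := normr_ge0 z0; lra.
have grow x : ((a - 1 + `|x - z0| / s)%:E <= psi x)%E.
  have [xs|xs] := leP `|x - z0| s.
    apply: le_trans (amin x); rewrite lee_fin.
    have : `|x - z0| / s <= 1 by rewrite ler_pdivrMr// mul1r.
    lra.
  pose t := s / `|x - z0|.
  have t0 : 0 < t by rewrite divr_gt0// (lt_trans s0).
  have t1 : t < 1 by rewrite /t ltr_pdivrMr ?mul1r// (lt_trans s0).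
  have zE : t *: x + (1 - t) *: z0 = z0 + t *: (x - z0).
    by rewrite scalerBl scale1r scalerBr; apply/matrixP => i j; rewrite !mxE; ring.
  have : ((a + 1)%:E <= psi (t *: x + (1 - t) *: z0))%E.
    apply: hr; rewrite zE.
    have nt : `|t *: (x - z0)| = s.
      by rewrite normrZ (gtr0_norm t0) /t mulfVK// gt_eqF// (lt_trans s0).
    have := ler_normB (z0 + t *: (x - z0)) z0; rewrite addrAC subrr add0r nt /s.
    by have := ler_norm r; lra.
  move=> /le_trans /(_ (cvx _ _ _ t0 t1)); rewrite za.
  case: (psi x) (gt0 x) => [b| |] //= _; last by rewrite leey.
  rewrite -!EFinM -EFinD !lee_fin => h.
  have : 1 <= t * (b - a) by lra.
  rewrite /t mulrAC ler_pdivlMr ?mul1r; last exact: lt_trans xs.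
  by move=> ?; rewrite -lerBrDl ler_pdivrMr//; lra.
pose e := ((n%:R + 1) * s)^-1.
have e0 : 0 < e by rewrite invr_gt0 mulr_gt0// ltr_wpDl.
exists e, (n%:R * (e * `|z0|) - a + 1); split => // w we.
apply/legendre_le => x; apply: le_trans (grow x); rewrite lee_fin.
have -> : dot w x = dot w z0 + dot w (x - z0) by rewrite -dotDr addrC subrK.
have h1 : dot w z0 <= n%:R * (e * `|z0|).
  apply: le_trans (ler_norm _) _; apply: le_trans (norm_dot _ _) _.
  by rewrite ler_wpM2l// ler_wpM2r.
have h2 : dot w (x - z0) <= `|x - z0| / s.
  apply: le_trans (ler_norm _) _; apply: le_trans (norm_dot _ _) _.
  apply: le_trans (_ : (n%:R + 1) * (e * `|x - z0|) <= _).
    by rewrite ler_pM// ?mulr_ge0// ?lerDl// ler_wpM2r.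
  by rewrite mulrA /e invfM mulrA divff ?gt_eqF ?ltr_wpDl// mul1r mulrC.
by lra.
Qed.

(** The quadratic penalty forces a minimizer z to exist.  Comparing z with the
    points t w + (1 - t) z and letting t -> 0 shows that k (x - z) is a subgradient
    of psi at z. *)
Lemma prox k x : 0 < k -> exists z (a : R), [/\ psi z = a%:E,
  (forall w, (a + k / 2 * dot (z - x) (z - x))%:E <=
     psi w + (k / 2 * dot (w - x) (w - x))%:E)%E
  & forall w, ((dot (k *: (x - z)) (w - z) + a)%:E <= psi w)%E].
Proof.
move=> k0; have [gt0 cvx [x0 x0p] lpsi cpsi] := psiC.
pose h w := k / 2 * dot (w - x) (w - x).
have h0 w : 0 <= h w by rewrite mulr_ge0 ?dotxx_ge0// divr_ge0// ltW.
have ch : continuous h.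
  move=> w.
  have hE : h = fun w => k / 2 * (\sum_(i < n) (w i 0 - x i 0) * (w i 0 - x i 0)).
    by apply/funext => v; rewrite /h /dot; congr (_ * _); apply: eq_bigr => i _; rewrite !mxE.
  rewrite hE; apply: (@continuousM _ _ (cst (k / 2))
     (fun w : 'cV[R]_n => \sum_(i < n) (w i 0 - x i 0) * (w i 0 - x i 0))).
    exact: cst_continuous.
  apply: continuous_big => [|i _ v]; first exact: add_continuous.
  have ci : {for v, continuous (fun w : 'cV[R]_n => w i 0 - x i 0)}.
    apply: (@continuousB _ _ _ (fun w : 'cV[R]_n => w i 0) (cst (x i 0))).
      exact: coord_continuous.
    exact: cst_continuous.
  exact: (continuousM ci ci).
have [z hz] : exists z, forall w, (psi z + (h z)%:E <= psi w + (h w)%:E)%E.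
  apply: exists_minimizer.
  - exact: lsc_add_continuous.
  - move=> M; have [r hr] := cpsi M; exists r => w /hr /le_trans; apply.
    by rewrite leeDl// lee_fin.
  - by exists x0; rewrite lte_add_pinfty// ltry.
have zfin : psi z \is a fin_num.
  rewrite fin_numE gt_eqF//=; apply/eqP => zy.
  have := hz x0; rewrite zy addye// leye_eq => /eqP.
  by case: (psi x0) x0p (gt0 x0).
exists z, (fine (psi z)); rewrite fineK//; split => // [w|w].
  by have := hz w; rewrite -[psi z]fineK.
have [wfin|] := boolP (psi w \is a fin_num); last first.
  by rewrite fin_numE gt_eqF// negbK => /eqP ->; rewrite leey.
rewrite -[psi w]fineK// lee_fin.
set a := fine (psi z); set b := fine (psi w).
rewrite -subr_ge0.
apply: (@ge0_of_affine_ge0 _ _ (k / 2 * dot (w - z) (w - z))) => t t0 t1.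
have := hz (t *: w + (1 - t) *: z).
move=> /le_trans /(_ (leeD (cvx _ _ _ t0 t1) (lexx _))).
rewrite -[psi z]fineK// -[psi w]fineK// -/a -/b -!EFinM -!EFinD lee_fin /h.
have -> : t *: w + (1 - t) *: z - x = (z - x) + t *: (w - z).
  by apply/matrixP => i j; rewrite !mxE; ring.
have -> : x - z = - (z - x) by rewrite opprB.
move: (z - x) (w - z) => u v.
rewrite !dotE (dotC v u) => H.
rewrite -(pmulr_rge0 _ t0); lra.
Qed.

(** The Fenchel-Moreau theorem: for k large, the subgradient inequality at the
    minimizer z of the penalized function, evaluated at x, gives the value
    psi z + k |x - z|^2, which exceeds b either because z is so near x that
    psi z > b, or because the penalty is large. *)
Lemma biconjugate x (b : R) : (b%:E < psi x)%E ->
  exists p (c : R), (legendre psi p <= c%:E)%E /\ b < dot p x - c.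
Proof.
move=> bx; have [_ _ _ lpsi _] := psiC.
have [z0 [m [_ mmin]]] := Conv_c_minimizer.
have [V /nbhs_ballP[d /= d0 dV] Vb] := lpsi _ _ bx.
(* If |x - z| >= d, then m + k |x - z|^2 > b, where m is the minimum of psi. *)
pose k := (`|b| + `|m| + 1) / d ^+ 2.
have k0 : 0 < k by rewrite divr_gt0 ?exprn_gt0// ltr_wpDl// addr_ge0.
have [z [a [za _ zsub]]] := prox x k0.
have dz := sqr_norm_le_dot (x - z).
exists (k *: (x - z)), (dot (k *: (x - z)) z - a); split.
  apply/legendre_le => w; apply: le_trans (zsub w).
  by rewrite lee_fin dotBr; lra.
have -> : dot (k *: (x - z)) x - (dot (k *: (x - z)) z - a) = a + k * dot (x - z) (x - z).
  by rewrite !dotE; ring.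
have [zd|zd] := ltP `|x - z| d.
  have : (b%:E < psi z)%E by apply/Vb/dV; rewrite -ball_normE.
  rewrite za lte_fin => /lt_le_trans; apply.
  by rewrite lerDl mulr_ge0 ?dotxx_ge0// ltW.
have ma : m <= a by have := mmin z; rewrite za lee_fin.
have : k * d ^+ 2 <= k * dot (x - z) (x - z).
  rewrite ler_wpM2l ?(ltW k0)//; apply: le_trans dz.
  by rewrite ler_sqr ?nnegrE// ltW.
rewrite {1}/k mulfVK ?expf_neq0 ?gt_eqF//.
by have := ler_norm b; have := ler_norm (- m); rewrite normrN; lra.
Qed.

End ConvexFunctions.

(** * Epi-multiplication, epi-sum and rotations *)

Section Operations.
Variables (R : realType) (n : nat).
Implicit Types (psi g : 'cV[R]_n -> \bar R) (x y z p q : 'cV[R]_n).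

Lemma Conv_c_lb psi : Conv_c psi -> exists m : R, forall x, (m%:E <= psi x)%E.
Proof. by move=> /Conv_c_minimizer[z [a [_ ?]]]; exists a. Qed.

Lemma Conv_c_epi_mul (l : R) psi : 0 < l -> Conv_c psi -> Conv_c (epi_mul l psi).
Proof.
move=> l0 [gt0 cvx [x0 x0p] lpsi /coerciveP cpsi]; split.
- move=> x; rewrite /epi_mul; case: (psi _) (gt0 (l^-1 *: x)) => [b| |] // _.
    by rewrite -EFinM ltNyr.
  by rewrite gt0_muley ?lte_fin.
- move=> x y t t0 t1; rewrite /epi_mul.
  have -> : l^-1 *: (t *: x + (1 - t) *: y) = t *: (l^-1 *: x) + (1 - t) *: (l^-1 *: y).
    by rewrite scalerDr !scalerA !(mulrC l^-1).
  have l0' : (0 <= l%:E)%E by rewrite lee_fin ltW.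
  apply: le_trans (lee_wpmul2l l0' (cvx _ _ _ t0 t1)) _.
  have t1' : 0 < 1 - t by lra.
  case: (psi (l^-1 *: x)) (gt0 (l^-1 *: x)) => [a| |] // _;
    case: (psi (l^-1 *: y)) (gt0 (l^-1 *: y)) => [b| |] // _;
    rewrite -?EFinM ?(gt0_muley (_ : 0 < _%:E)%E) ?lte_fin//;
    rewrite -?EFinD -?EFinM ?addye ?addey// ?(gt0_muley (_ : 0 < _%:E)%E) ?lte_fin//.
  by rewrite lee_fin; lra.
- exists (l *: x0); rewrite /epi_mul scalerA mulVf ?gt_eqF// scale1r.
  case: (psi x0) x0p (gt0 x0) => [b| |] // _ _; exact: ltry.
- move=> x a; rewrite lte_scale// => ax.
  have cl : continuous (fun x : 'cV[R]_n => l^-1 *: x) by exact: scaler_continuous.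
  have [V xV Va] := lsc_comp cl lpsi ax.
  by exists V => // y /Va; rewrite lte_scale.
- apply/coerciveP => M; have [r hr] := cpsi (l^-1 * M).
  exists (l * r) => x rx; rewrite lee_scale//; apply: hr.
  by rewrite normrZ gtr0_norm ?invr_gt0// mulrC ltr_pdivlMr// mulrC.
Qed.

Lemma legendre_epi_mul (l : R) psi p : 0 < l -> Conv_c psi ->
  (legendre (epi_mul l psi) p = l%:E * legendre psi p)%E.
Proof.
move=> l0 psiC; apply: ereal_eq_ub => c; rewrite scale_lee//.
rewrite (legendre_le (Conv_c_epi_mul l0 psiC)) (legendre_le psiC); split => h x.
  have := h (l *: x); rewrite /epi_mul scalerA mulVf ?gt_eqF// scale1r lee_scale//.
  by rewrite !dotE mulrBr mulKf ?gt_eqF.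
by rewrite lee_scale//; have := h (l^-1 *: x); rewrite !dotE mulrBr.
Qed.

Lemma epi_sum_le g1 g2 u v : (epi_sum g1 g2 (u + v)%R <= g1 u + g2 v)%E.
Proof. by apply: ereal_inf_lbound; exists v => //; rewrite addrK. Qed.

Lemma epi_sum_lt g1 g2 x a : (epi_sum g1 g2 x < a)%E ->
  exists u v, u + v = x /\ (g1 u + g2 v < a)%E.
Proof.
move=> /ereal_inf_lt[_ [v _ <-] va]; exists (x - v), v.
by rewrite subrK.
Qed.

Lemma le_epi_sum g1 g2 x a : (forall u v, u + v = x -> (a <= g1 u + g2 v)%E) ->
  (a <= epi_sum g1 g2 x)%E.
Proof.
move=> h; apply: le_ereal_inf_tmp => _ [v _ <-]; apply: h; exact: subrK.
Qed.

(** Only y in a compact ball matter for the infimum, as g2 is large outside of it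
    and g1 is bounded below; on that ball, joint lower semicontinuity of
    g1 (x - y) + g2 y is uniform in y. *)
Lemma lsc_epi_sum g1 g2 : Conv_c g1 -> Conv_c g2 ->
  lower_semicontinuous (epi_sum g1 g2).
Proof.
move=> C1 C2 x a /ereal_between[b [ab bS]].
have [gt1 _ _ lsc1 _] := C1; have [gt2 _ _ lsc2 /coerciveP co2] := C2.
have [m1 hm1] := Conv_c_lb C1.
have [r hr] := co2 (b - m1).
have cK := (compact_near_coveringP _).1 (@compact_ball R n r).
have HV : \forall x' \near x, [set y : 'cV[R]_n | `|y| <= r] `<=`
    [set y | (b%:E < g1 (x' - y)%R + g2 y)%E].
  apply: (cK _ _ (fun x' y => b%:E < g1 (x' - y)%R + g2 y)%E (nbhs_filter x)) => y _.
  have [//|//||c1 [c2 [h1 h2 bc]]] := @lte_split _ b (g1 (x - y)) (g2 y).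
    apply: lt_le_trans bS _.
    by rewrite -{1}[x](subrK y); exact: epi_sum_le.
  have [V1 /nbhs_ballP[d /= d0 dV1] h1'] := lsc1 _ _ h1.
  have [V2 V2y h2'] := lsc2 _ _ h2.
  exists (V2 `&` ball y (d / 2), ball x (d / 2)).
    split => /=; last by apply: nbhsx_ballx; rewrite divr_gt0.
    by apply: filterI => //; apply: nbhsx_ballx; rewrite divr_gt0.
  move=> [y' x'] /= [[V2y' yy'] xx'].
  have g1x : (c1%:E < g1 (x' - y')%R)%E.
    apply/h1'/dV1; move: yy' xx'; rewrite -!ball_normE /= => yy' xx'.
    have -> : x - y - (x' - y') = (x - x') - (y - y').
      by rewrite !opprB addrACA [- y + _]addrC addrACA.
    by apply: le_lt_trans (ler_normB _ _) _; lra.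
  apply: lt_le_trans (leeD (ltW g1x) (ltW (h2' _ V2y'))).
  by rewrite -EFinD lte_fin.
exists [set x' | [set y : 'cV[R]_n | `|y| <= r] `<=`
    [set y | (b%:E < g1 (x' - y)%R + g2 y)%E]] => // x' hx'.
apply: lt_le_trans ab _; apply: le_epi_sum => u v uv.
have [vr|vr] := leP `|v| r.
  by have := hx' _ vr; rewrite /= -uv addrK; exact: ltW.
apply: le_trans (leeD (hm1 u) (hr _ vr)).
by rewrite -EFinD lee_fin; lra.
Qed.

Lemma Conv_c_epi_sum g1 g2 : Conv_c g1 -> Conv_c g2 -> Conv_c (epi_sum g1 g2).
Proof.
move=> C1 C2; have [gt1 cvx1 [x1 x1p] lsc1 /coerciveP co1] := C1.
have [gt2 cvx2 [x2 x2p] lsc2 /coerciveP co2] := C2.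
have [m1 hm1] := Conv_c_lb C1; have [m2 hm2] := Conv_c_lb C2.
have gt0 x : (-oo < epi_sum g1 g2 x)%E.
  apply: (@lt_le_trans _ _ (m1 + m2)%:E); first exact: ltNyr.
  by apply: le_epi_sum => u v _; rewrite EFinD leeD.
split => //; last 2 first.
- exact: lsc_epi_sum.
- apply/coerciveP => M; have [r1 hr1] := co1 (M - m2); have [r2 hr2] := co2 (M - m1).
  exists (r1 + r2) => x rx; apply: le_epi_sum => u v uv.
  have [ur|ur] := ltP r1 `|u|.
    apply: le_trans (leeD (hr1 _ ur) (hm2 v)).
    by rewrite -EFinD lee_fin; lra.
  apply: le_trans (leeD (hm1 u) (hr2 v _)); first by rewrite -EFinD lee_fin; lra.
  by have := ler_normD u v; rewrite uv; lra.
- move=> x y t t0 t1.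
  have key (a b : R) : (epi_sum g1 g2 x < a%:E)%E -> (epi_sum g1 g2 y < b%:E)%E ->
      (epi_sum g1 g2 (t *: x + (1 - t) *: y)%R <= (t * a + (1 - t) * b)%:E)%E.
    move=> /epi_sum_lt[u [v [<- uva]]] /epi_sum_lt[u' [v' [<- uvb]]].
    have -> : t *: (u + v) + (1 - t) *: (u' + v') =
        (t *: u + (1 - t) *: u') + (t *: v + (1 - t) *: v').
      by rewrite !scalerDr addrACA.
    apply: le_trans (epi_sum_le _ _ _ _) _.
    apply: le_trans (leeD (cvx1 _ _ _ t0 t1) (cvx2 _ _ _ t0 t1)) _.
    move: uva uvb.
    case: (g1 u) (gt1 u) => [b1| |] // _; case: (g2 v) (gt2 v) => [b2| |] // _.
    case: (g1 u') (gt1 u') => [b3| |] // _; case: (g2 v') (gt2 v') => [b4| |] // _.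
    rewrite -!EFinM -!EFinD !lte_fin lee_fin => h1 h2.
    have := ler_pM2l t0 (b1 + b2) a; rewrite (ltW h1) => h3.
    have t1' : 0 < 1 - t by lra.
    by have := ler_pM2l t1' (b3 + b4) b; rewrite (ltW h2); lra.
  have t1' : 0 < 1 - t by lra.
  case: (epi_sum g1 g2 x) (gt0 x) key => [a| |] // _;
    case: (epi_sum g1 g2 y) (gt0 y) => [b| |] // _ key;
    rewrite ?gt0_muley ?lte_fin// ?addye ?addey// ?leey//.
  apply/lee_addgt0Pr => e e0; apply: le_trans (key (a + e) (b + e) _ _) _.
  - by rewrite lte_fin; lra.
  - by rewrite lte_fin; lra.
  - by rewrite -!EFinM -!EFinD lee_fin; lra.
- exists (x1 + x2); apply: le_lt_trans (epi_sum_le _ _ _ _) _.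
  exact: lte_add_pinfty.
Qed.

(** Affine minorants of the epi-sum with slope p are sums of affine minorants of
    the summands with the same slope. *)
Lemma legendre_epi_sum g1 g2 p : Conv_c g1 -> Conv_c g2 ->
  (legendre (epi_sum g1 g2) p = legendre g1 p + legendre g2 p)%E.
Proof.
move=> C1 C2; apply: ereal_eq_ub => c.
have L1 := legendre_gtNy C1 p; have L2 := legendre_gtNy C2 p.
rewrite (legendre_le (Conv_c_epi_sum C1 C2)); split => [h|].
  rewrite leNgt; apply/negP => /(lte_split L1 L2)[c1 [c2 []]].
  move=> /ereal_sup_gt[_ [u _ <-] uc] /ereal_sup_gt[_ [v _ <-] vc] cc.
  have [gt1 _ _ _ _] := C1; have [gt2 _ _ _ _] := C2.
  have := le_trans (h (u + v)) (epi_sum_le _ _ _ _).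
  move: uc vc (gt1 u) (gt2 v); case: (g1 u) => [b1| |] //; case: (g2 v) => [b2| |] //.
  by rewrite -!EFinB -!EFinD !lte_fin lee_fin dotDr => uc vc _ _ h'; clear L1 L2; lra.
have := (legendre_le C1 p); have := (legendre_le C2 p).
case: (legendre g1 p) L1 => [c1| |] // _; case: (legendre g2 p) L2 => [c2| |] // _.
move=> H2 H1; rewrite -EFinD lee_fin => cc x.
have {}H2 := (H2 c2).1 (lexx _); have {}H1 := (H1 c1).1 (lexx _).
apply: le_epi_sum => u v <-; apply: le_trans (leeD (H1 u) (H2 v)).
by rewrite -EFinD lee_fin dotDr; lra.
Qed.

Lemma Ogrp_invmx (A : 'M[R]_n) : Ogrp A -> invmx A = A^T.
Proof.
move=> oA; have uA : A \in unitmx by have [_ ->] := mulmx1_unit oA.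
by rewrite -[LHS]mul1mx -oA mulmxK.
Qed.

Lemma Ogrp_mul_tr (A : 'M[R]_n) : Ogrp A -> A *m A^T = 1%:M.
Proof. exact: mulmx1C. Qed.

Lemma enorm_trmx (A : 'M[R]_n) x : Ogrp A -> enorm (A^T *m x) = enorm x.
Proof.
by move=> oA; rewrite /enorm dot_trmx trmxK mulmxA Ogrp_mul_tr// mul1mx.
Qed.

Lemma mulmx_continuous (A : 'M[R]_n) : continuous (fun x : 'cV[R]_n => A *m x).
Proof.
move=> x U /nbhs_ballP[e /= e0 eU]; apply/nbhs_ballP.
have c0 : 0 < n%:R * `|A| + 1 by rewrite ltr_wpDl// mulr_ge0.
exists (e / (n%:R * `|A| + 1)); first by rewrite /= divr_gt0.
move=> y; rewrite -ball_normE /= ltr_pdivlMr// => xy.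
apply: eU; rewrite -ball_normE /= -mulmxBr.
apply: le_lt_trans (norm_mulmx _ _) _; apply: le_lt_trans xy.
by rewrite mulrA mulrC ler_wpM2l// lerDl.
Qed.

Lemma Conv_c_Ogrp (A : 'M[R]_n) psi : Ogrp A -> Conv_c psi ->
  Conv_c (fun x => psi (invmx A *m x)).
Proof.
move=> oA [gt0 cvx [x0 x0p] lpsi cpsi]; rewrite (Ogrp_invmx oA); split => //.
- by move=> x y t t0 t1; rewrite mulmxDr -!scalemxAr; exact: cvx.
- by exists (A *m x0); rewrite mulmxA oA mul1mx.
- by apply: (lsc_comp _ lpsi); exact: mulmx_continuous.
- by move=> M; have [r hr] := cpsi M; exists r => x; rewrite -(enorm_trmx x oA); exact: hr.
Qed.

Lemma legendre_Ogrp (A : 'M[R]_n) psi p : Ogrp A -> Conv_c psi ->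
  legendre (fun x => psi (invmx A *m x)) p = legendre psi (invmx A *m p).
Proof.
move=> oA C; apply: ereal_eq_ub => c.
rewrite (legendre_le (Conv_c_Ogrp oA C)) (legendre_le C) (Ogrp_invmx oA).
split => h x; last by have := h (A^T *m x); rewrite dot_trmx trmxK mulmxA Ogrp_mul_tr// mul1mx.
by have := h (A *m x); rewrite mulmxA oA mul1mx dotC dot_trmx dotC.
Qed.

Lemma epi_mul_sum (l : R) g1 g2 :
  0 < l -> epi_mul l (epi_sum g1 g2) = epi_sum (epi_mul l g1) (epi_mul l g2).
Proof.
move=> l0; have ln0 : l != 0 by rewrite gt_eqF.
apply/funext => x; apply/eqP; rewrite eq_le; apply/andP; split.
  apply: le_epi_sum => u v <-; rewrite /epi_mul -scale_adde ?(ltW l0)// scalerDr.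
  by apply: lee_wpmul2l; [rewrite lee_fin ltW|exact: epi_sum_le].
apply: lee_lt_real => r rS; rewrite /epi_mul lee_scale//; apply: le_epi_sum => u v uv.
rewrite -lee_scale// scale_adde ?(ltW l0)//; apply: le_trans (ltW rS) _.
have -> : x = l *: u + l *: v by rewrite -scalerDr uv scalerA divff// scale1r.
apply: le_trans (epi_sum_le _ _ _ _) _.
by rewrite /epi_mul !scalerA mulVf// !scale1r.
Qed.

End Operations.

(** * Convex functionals *)

Section Jensen.
Variables (R : realType) (n : nat) (Psi : ('cV[R]_n -> \bar R) -> \bar R).

Hypothesis PsiC : epi_convex Psi.

(** Induction on the number of terms, splitting off the first one and rescaling the
    remaining weights.  The combination is described by its Legendre transform,
    which is linear in the weights, instead of an iterated epi-sum. *)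
Lemma finite_jensen (M : \bar R) (I : eqType) (phi : I -> 'cV[R]_n -> \bar R)
    (s : seq I) (w : I -> R) :
  (forall i, Conv_c (phi i)) -> (forall i, (Psi (phi i) <= M)%E) ->
  (forall i, i \in s -> 0 < w i) -> \sum_(i <- s) w i = 1 ->
  exists2 phi', Conv_c phi' & (Psi phi' <= M)%E /\
   forall p, legendre phi' p = (\sum_(i <- s) (w i)%:E * legendre (phi i) p)%E.
Proof.
move=> Cphi Mphi; elim: s w => [|i s IH] w ws.
  by rewrite big_nil => /esym/eqP; rewrite oner_eq0.
have wi : 0 < w i by apply: ws; rewrite mem_head.
have wpos j : j \in s -> 0 < w j by move=> js; apply: ws; rewrite inE js orbT.
rewrite big_cons => w1.
case: s IH ws w1 wpos => [_ _|k s IH ws w1 wpos].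
  rewrite big_nil addr0 => w1 _; exists (phi i) => //; split=> // p.
  by rewrite big_cons big_nil adde0 w1 mul1e.
set s' := k :: s in IH ws w1 wpos *.
have S0 : 0 < \sum_(j <- s') w j.
  rewrite big_cons ltr_pwDl ?wpos ?mem_head// big_seq sumr_ge0// => j js.
  by rewrite ltW// wpos// inE js orbT.
have SE : \sum_(j <- s') w j = 1 - w i by lra.
have wi1 : w i < 1 by lra.
have wi1' : 0 < 1 - w i by lra.
have [||phi' C' [M' L']] := IH (fun j => w j / (1 - w i)).
- by move=> j js; rewrite divr_gt0// wpos.
- by rewrite -mulr_suml SE divff// gt_eqF.
exists (epi_sum (epi_mul (w i) (phi i)) (epi_mul (1 - w i) phi')).
  by apply: Conv_c_epi_sum; exact: Conv_c_epi_mul.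
split; first by apply: le_trans (PsiC (Cphi i) C' wi wi1) _; exact: convex_comb_le.
move=> p; rewrite big_cons legendre_epi_sum ?legendre_epi_mul//; try exact: Conv_c_epi_mul.
congr (_ + _)%E; rewrite L' scale_sume ?(ltW wi1')//.
by apply: eq_bigr => j _; rewrite muleA -EFinM mulrCA divff ?gt_eqF// mulr1.
Qed.

Lemma finite_jensen_fintype (M : \bar R) (I : finType) (phi : I -> 'cV[R]_n -> \bar R)
    (w : I -> R) :
  (forall i, Conv_c (phi i)) -> (forall i, (Psi (phi i) <= M)%E) ->
  (forall i, 0 <= w i) -> \sum_i w i = 1 ->
  exists2 phi', Conv_c phi' & (Psi phi' <= M)%E /\
   forall p, legendre phi' p = (\sum_i (w i)%:E * legendre (phi i) p)%E.
Proof.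
move=> Cphi Mphi w0 w1.
have wE i : 0 < w i = (w i != 0) by rewrite lt0r w0 andbT.
have [||phi' C' [M' L']] :=
    @finite_jensen M I phi [seq i <- enum I | 0 < w i] w Cphi Mphi.
- by move=> i; rewrite mem_filter => /andP[].
- rewrite big_filter -w1 big_enum_cond /= big_mkcond /=; apply: eq_bigr => i _.
  by rewrite wE; case: eqP => //= ->.
exists phi' => //; split => // p; rewrite L' big_filter big_enum_cond /= big_mkcond /=.
by apply: eq_bigr => i _; rewrite wE; case: eqP => //= ->; rewrite mul0e.
Qed.

End Jensen.

Lemma one_dimensional_case (R : realType) (Psi : ('cV[R]_1 -> \bar R) -> \bar R)
    (psi : 'cV[R]_1 -> \bar R) :
  epi_convex Psi -> invariant_under (@Ogrp R 1) Psi -> Conv_c psi ->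
  (Psi (rot1 psi) <= Psi psi)%E.
Proof.
move=> cPsi iPsi C.
have tN : (- 1%:M : 'M[R]_1)^T = - 1%:M by apply/matrixP => i j; rewrite !mxE eq_sym.
have oN : Ogrp (- 1%:M : 'M[R]_1) by rewrite /Ogrp /= tN mulNmx mulmxN opprK mul1mx.
have E : (fun x => psi (- x)) = fun x => psi (invmx (- 1%:M) *m x).
  by apply/funext => x; rewrite (Ogrp_invmx oN) tN mulNmx mul1mx.
have half : (1 - 2^-1 : R) = 2^-1 by field.
have h0 : 0 < 2^-1 :> R by rewrite invr_gt0.
have h1 : 2^-1 < 1 :> R by rewrite invf_lt1// ltr1n.
have C' : Conv_c (fun x => psi (- x)) by rewrite E; exact: Conv_c_Ogrp.
rewrite /rot1 epi_mul_sum//.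
have := cPsi _ _ _ C C' h0 h1; rewrite {1}half => /le_trans; apply.
by apply: convex_comb_le => //; rewrite E iPsi.
Qed.

(** * Riemann sums on the rotation group *)

(** In contrast to the usual statement for integrable functions, both sides may be
    infinite: positive and negative parts are compared separately. *)
Lemma ae_le_integral (d : measure_display) (T : measurableType d)
    (R : realType) (mu : {measure set T -> \bar R}) (D : set T) (f g : T -> \bar R) :
  measurable D -> measurable_fun D f -> measurable_fun D g ->
  {ae mu, forall x, D x -> (f x <= g x)%E} ->
  (\int[mu]_(x in D) f x <= \int[mu]_(x in D) g x)%E.
Proof.
move=> mD mf mg fg; rewrite integralE [leRHS]integralE leeB//.
- apply: ae_ge0_le_integral => //.
  + exact: measurable_funepos.
  + exact: measurable_funepos.
  + apply: filterS fg => x fg Dx; apply: (@funepos_le _ _ [set x] f g); last by rewrite inE.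
    by move=> y /set_mem ->; exact: fg.
- apply: ae_ge0_le_integral => //.
  + exact: measurable_funeneg.
  + exact: measurable_funeneg.
  + apply: filterS fg => x fg Dx; apply: (@funeneg_le _ _ [set x] f g); last by rewrite inE.
    by move=> y /set_mem ->; exact: fg.
Qed.

Section BorelMatrices.
Variables (R : realType) (n : nat).
Local Notation T := (borelM R n).
Local Notation SO := (@SOgrp R n : set T).

Lemma open_borelM (A : set 'M[R]_n) : open A -> measurable (A : set T).
Proof. by move=> oA; exact: sub_sigma_algebra. Qed.

Lemma lsc_measurable_borelM (f : 'M[R]_n -> \bar R) :
  lower_semicontinuous f -> measurable_fun setT (f : T -> \bar R).
Proof.
move=> lf; apply: (measurability _ (ErealGenOInfty.measurableE R)).
move=> /= _ [_ [a ->]] <-; apply: measurableI => //; apply: open_borelM.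
by rewrite preimage_itvoy; move/lower_semicontinuousP : lf; exact.
Qed.

Lemma measurable_coord (i j : 'I_n) : measurable_fun setT (fun A : T => (A : 'M[R]_n) i j).
Proof.
apply: (measurability _ (RGenOpens.measurableE R)).
move=> /= _ [_ [a [b ->]] <-]; rewrite setTI; apply: open_borelM.
apply: open_comp => [A _|]; last exact: interval_open.
exact: coord_continuous.
Qed.

Lemma measurable_SOgrp : measurable SO.
Proof.
have -> : SO = (\bigcap_(ij in [set: 'I_n * 'I_n])
    (fun A : T => \sum_(k < n) (A : 'M[R]_n) k ij.1 * (A : 'M[R]_n) k ij.2)
       @^-1` [set (1%:M : 'M[R]_n) ij.1 ij.2])
  `&` (fun A : T => \det (A : 'M[R]_n)) @^-1` [set 1].
  apply/seteqP; split => [A [oA dA]|A [oA dA]]; split => //=.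
    move=> [i j] _ /=; rewrite -oA mxE.
    by apply: eq_bigr => k _; rewrite mxE.
  apply/matrixP => i j; rewrite mxE -(oA (i, j) I) /=.
  by apply: eq_bigr => k _; rewrite mxE.
apply: measurableI.
  apply: fin_bigcap_measurable; first exact: finite_finset.
  move=> [i j] _; rewrite -[X in measurable X]setTI.
  suff : measurable_fun setT (fun A : T => \sum_(k < n) (A : 'M[R]_n) k i * (A : 'M[R]_n) k j).
    by apply => //; exact: measurable_set1.
  by apply: measurable_sum => k; apply: measurable_funM; exact: measurable_coord.
rewrite -[X in measurable X]setTI.
suff : measurable_fun setT (fun A : T => \det (A : 'M[R]_n)).
  by apply => //; exact: measurable_set1.
apply: measurable_sum => s; apply: measurable_funM; first exact: measurable_cst.
by apply: measurable_prod => i _; exact: measurable_coord.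
Qed.

Lemma SOgrp_coord (A : 'M[R]_n) i j : SOgrp A -> `|A i j| <= 1.
Proof.
move=> [oA _]; have := congr1 (fun B : 'M[R]_n => B j j) oA.
rewrite !mxE eqxx (bigD1 i)//= mxE => h.
have : A i j ^+ 2 <= 1.
  rewrite -[leRHS]h expr2 lerDl sumr_ge0// => k _.
  by rewrite mxE -expr2 sqr_ge0.
by rewrite -real_normK ?num_real// expr_le1.
Qed.

(** Entries of rotations lie in [-1, 1]; the cell of a rotation records its entries
    up to an error less than 1 / N. *)
Definition cell (N : nat) (A : T) : 'M['I_(2 * N).+1]_n :=
  \matrix_(i, j) inord (Num.truncn (((A : 'M[R]_n) i j + 1) * N%:R)).

Lemma truncn_coord N (A : T) i j : SO A ->
  (cell N A i j)%:R <= ((A : 'M[R]_n) i j + 1) * N%:R < (cell N A i j).+1%:R.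
Proof.
move=> sA; have := SOgrp_coord i j sA; rewrite ler_norml => /andP[A1 A2].
have x0 : 0 <= ((A : 'M[R]_n) i j + 1) * N%:R by rewrite mulr_ge0//; lra.
rewrite mxE inordK; first exact: truncn_itv.
have /andP[h _] := truncn_itv x0.
rewrite ltnS -(ler_nat R); apply: le_trans h _.
by rewrite natrM ler_wpM2r//; lra.
Qed.

Lemma cell_dist N (A B : T) : (0 < N)%N -> SO A -> SO B -> cell N A = cell N B ->
  `|(A : 'M[R]_n) - B| <= N%:R^-1.
Proof.
move=> N0 sA sB AB; have N0' : 0 < N%:R :> R by rewrite ltr0n.
apply: norm_coordP => [|i j]; first by rewrite invr_ge0 ltW.
have /andP[a1 a2] := truncn_coord N i j sA; have /andP[b1 b2] := truncn_coord N i j sB.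
rewrite AB in a1 a2; rewrite !mxE.
move: a1 a2 b1 b2; rewrite -natr1.
move: ((cell N B i j)%:R : R) ((A : 'M[R]_n) i j) ((B : 'M[R]_n) i j) => c a b a1 a2 b1 b2.
rewrite -[leRHS]mul1r ler_pdivlMr//.
rewrite -[X in _ * X]gtr0_norm// -normrM ler_norml; apply/andP; split; lra.
Qed.

Lemma measurable_cell N (k : 'M['I_(2 * N).+1]_n) :
  measurable (SO `&` [set A : T | cell N A = k]).
Proof.
have -> : SO `&` [set A : T | cell N A = k] = SO `&`
   \bigcap_(ij in [set: 'I_n * 'I_n])
    (fun A : T => ((A : 'M[R]_n) ij.1 ij.2 + 1) * N%:R) @^-1`
      [set` `[(k ij.1 ij.2)%:R, (k ij.1 ij.2).+1%:R[].
  apply/seteqP; split => [A [sA <-]|A [sA kA]]; split => //=.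
    by move=> [i j] _ /=; rewrite in_itv/=; exact: truncn_coord.
  apply/matrixP => i j; have := kA (i, j) I; rewrite /= in_itv /= => h.
  by rewrite mxE (truncn_def h) inord_val.
apply: measurableI; first exact: measurable_SOgrp.
apply: fin_bigcap_measurable; first exact: finite_finset.
move=> [i j] _; rewrite -[X in measurable X]setTI.
suff : measurable_fun setT (fun A : T => ((A : 'M[R]_n) i j + 1) * N%:R).
  by apply => //; exact: measurable_itv.
apply: measurable_funM => //; apply: measurable_funD => //.
exact: measurable_coord.
Qed.

(** A partition of SO(n) by [cell] into pieces of diameter at most delta, with their
    masses w and points theta in them: a function that is at most, or at least, a i
    on the i-th piece has an integral that is at most, or at least, the
    corresponding Riemann sum. *)
Lemma discretization (mu : probability T R) (delta : R) :
  mu SO = 1%E -> 0 < delta ->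
  exists (I : finType) (w : I -> R) (theta : I -> 'M[R]_n),
  [/\ forall i, 0 <= w i, \sum_i w i = 1, forall i, SOgrp (theta i) &
   forall (G : T -> \bar R) (a : I -> \bar R), measurable_fun SO G ->
    (forall i, (-oo < a i)%E) ->
    ((forall i eta, SOgrp eta -> `|eta - theta i| <= delta -> (G eta <= a i)%E) ->
      (\int[mu]_(eta in SO) G eta <= \sum_i (w i)%:E * a i)%E) /\
    ((forall i eta, SOgrp eta -> `|eta - theta i| <= delta -> (a i <= G eta)%E) ->
      (\sum_i (w i)%:E * a i <= \int[mu]_(eta in SO) G eta)%E)].
Proof.
move=> muSO d0.
pose N := Num.bound delta^-1.
have Nd : delta^-1 < N%:R by apply: archi_boundP; rewrite invr_ge0 ltW.
have N0 : (0 < N)%N by rewrite -(ltr0n R); apply: lt_trans Nd; rewrite invr_gt0.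
have Nd' : N%:R^-1 <= delta.
  by rewrite -[leRHS]invrK lef_pV2 ?posrE ?invr_gt0 ?ltr0n// ltW.
pose I := 'M['I_(2 * N).+1]_n.
pose P (k : I) : set T := SO `&` [set A : T | cell N A = k].
have mP k : measurable (P k) by exact: measurable_cell.
have mSO := measurable_SOgrp.
pose w k := fine (mu (P k)).
have wE k : (w k)%:E = mu (P k) by rewrite fineK// fin_num_measure.
(* Empty cells get the identity matrix as a dummy point. *)
pose theta (k : I) : 'M[R]_n := xget 1%:M (P k : set 'M[R]_n).
have stepE (c : I -> R) (A : T) : SO A ->
    (\sum_k (c k)%:E * (\1_(P k) A)%:E)%E = (c (cell N A))%:E.
  move=> sA; rewrite (bigD1 (cell N A))//= big1 ?adde0.
    by rewrite indicE mem_set// mule1.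
  move=> k kA; rewrite indicE memNset ?mule0// => -[_ /= kE].
  by rewrite kE eqxx in kA.
have iP k : mu.-integrable SO (fun x => (\1_(P k) x)%:E).
  by apply: (integrableS _ _ (@subsetT _ _) (integrable_indic _ _)).
have iE (c : I -> R) : (\int[mu]_(eta in SO) (c (cell N eta))%:E = (\sum_k w k * c k)%:E)%E.
  rewrite (eq_integral (fun A => \sum_k (c k)%:E * (\1_(P k) A)%:E)%E); last first.
    by move=> A; rewrite inE => sA; rewrite stepE.
  rewrite integral_sum//; last by move=> k; exact: integrableZl.
  rewrite -sumEFin; apply: eq_bigr => k _.
  rewrite integralZl// integral_indic// EFinM muleC wE; congr (mu _ * _)%E.
  by apply/setIidl => A [].
have w0 k : 0 <= w k by exact: fine_ge0.
exists I, w, theta; split.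
- exact: w0.
- apply: EFin_inj; have := iE (fun=> 1); rewrite integral_cst// mul1e.
  move=> h; apply: etrans muSO; rewrite h.
  by congr (_%:E); apply: eq_bigr => k _; rewrite mulr1.
- move=> k; rewrite /theta; case: xgetP => [A _ [//]|_].
  by split; rewrite ?det1// /Ogrp /= trmx1 mul1mx.
move=> G a mG aNy.
have near_theta (A : T) : SO A -> `|(A : 'M[R]_n) - theta (cell N A)| <= delta.
  move=> sA; apply: le_trans Nd'; rewrite /theta.
  case: xgetP => [B _ [sB BA]|/(_ A)]; last by case; split.
  exact: cell_dist.
have mstep (c : I -> R) : measurable_fun SO (fun A : T => (c (cell N A))%:E).
  apply: (eq_measurable_fun (fun A : T => \sum_k (c k)%:E * (\1_(P k) A)%:E)%E).
    by move=> A; rewrite inE => sA; exact: stepE.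
  apply: emeasurable_sum => k; apply: measurable_funeM.
  by apply/measurable_EFinP; exact: measurable_indic.
split=> aG; last first.
  apply: weighted_sum_le => // c ca; rewrite -iE.
  apply: ae_le_integral => //; apply: aeW => A sA.
  by apply: le_trans (ca _) _; apply: aG => //; exact: near_theta.
have [afin|/existsNP[i /not_implyP[wi /negP]]] :=
    pselect (forall i, 0 < w i -> (a i < +oo)%E); last first.
  rewrite -leNgt leye_eq => /eqP ai.
  by rewrite (weighted_sum_infty w0 aNy wi ai) leey.
rewrite weighted_sum_fine// -iE; apply: ae_le_integral => //.
  exact: (mstep (fun i => fine (a i))).
(* The value of a on a cell of mass zero may be infinite, and then its real part
   is no upper bound on that cell. *)
have hnull : \forall A \ae mu, forall k, w k = 0 -> ~ P k A.
  apply: filter_forall => k; have [wk|wk] := eqVneq (w k) 0; last first.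
    by apply: aeW => A /eqP; rewrite (negPf wk).
  exists (P k); split => //; first by rewrite -wE wk.
  by move=> A /= /not_implyP[_ /contrapT].
apply: filterS hnull => A nullA sA.
have aA : (a (cell N A) < +oo)%E.
  apply: afin; rewrite lt0r w0 andbT; apply/eqP => /nullA; apply.
  by split.
apply: le_trans (aG _ _ sA (near_theta _ sA)) _.
by case: (a (cell N A)) (aNy (cell N A)) aA.
Qed.

End BorelMatrices.

(** * Epi-convergence from Legendre transforms *)

(** For each j, choose z satisfying Q m j with m <= j as large as possible. *)
Lemma diagonal_selection (T : Type) (z0 : T) (Q : nat -> nat -> T -> Prop) :
  (forall m, \forall j \near \oo, exists z, Q m j z) ->
  exists z_ : nat -> T, forall m, \forall j \near \oo,
    exists2 m', (m <= m')%N & Q m' j (z_ j).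
Proof.
move=> HQ.
have /choice[z_ hz] : forall j, exists z, forall m, (m <= j)%N ->
    (exists z', Q m j z') -> exists2 m', (m <= m')%N & Q m' j z.
  move=> j; pose b m := (m <= j)%N && `[< exists z', Q m j z' >].
  have [exb|nob] := pselect (exists m, b m); last first.
    exists z0 => m mj Qm; exfalso; apply: nob; exists m.
    by rewrite /b mj; apply/asboolP.
  have bj m : b m -> (m <= j)%N by move=> /andP[].
  case: (ex_maxnP exb bj) => m' /andP[_ /asboolP[z Qz]] max.
  exists z => m mj Qm; exists m' => //; apply: max.
  by rewrite /b mj; apply/asboolP.
exists z_ => m; near=> j; apply: hz; near: j; last exact: HQ.
exact: nbhs_infty_ge.
Unshelve. all: by end_near. Qed.

(** The hypotheses [upper] and [lower] say that, up to the contraction t and the error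
    (1 - t) C, the transforms of psi_ j and phi bound each other on bounded sets. *)
Section EpiConvergence.
Variables (R : realType) (n : nat).
Variables (psi_ : nat -> 'cV[R]_n -> \bar R) (phi : 'cV[R]_n -> \bar R) (C C1 : R).
Hypothesis psi_C : forall j, Conv_c (psi_ j).
Hypothesis phiC : Conv_c phi.
Hypothesis upper : forall B t : R, 0 < t -> t < 1 -> \forall j \near \oo,
  forall p, `|p| <= B ->
    (legendre (psi_ j) (t *: p) <= t%:E * legendre phi p + ((1 - t) * C)%:E)%E.
Hypothesis lower : forall B t : R, 0 < t -> t < 1 -> \forall j \near \oo,
  forall p, `|p| <= B ->
    (legendre phi (t *: p) <= t%:E * legendre (psi_ j) p + ((1 - t) * C)%:E)%E.
Hypothesis C1_ge0 : 0 <= C1.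
Hypothesis minorant : forall j p, ((- (C1 * (1 + `|p|)))%:E <= legendre (psi_ j) p)%E.

(** An affine minorant y |-> <p, y> - c of phi becomes, after shrinking its slope to
    t p, an affine minorant of psi_ j with a value near x that is hardly smaller. *)
Lemma epi_liminf (x : 'cV[R]_n) (x_ : nat -> 'cV[R]_n) (a : R) :
  x_ @ \oo --> x -> (a%:E < phi x)%E -> \forall j \near \oo, (a%:E <= psi_ j (x_ j))%E.
Proof.
move=> xx /(biconjugate phiC)[p [c [pc apc]]].
have [t [t0 t1 at_]] := convex_comb_gt (- C) apc.
have h1 : dot (x_ j) p @[j --> \oo] --> dot x p.
  exact: (cvg_comp _ _ xx (@continuous_dotl _ _ p x)).
have b0 : dot x p - (t * (dot p x - c) + (1 - t) * - C - a) / t < dot x p.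
  by rewrite ltrBlDr ltrDl divr_gt0//; lra.
have h2 := cvgr_gt _ h1 _ b0.
near=> j.
have [psi_gt _ _ _ _] := psi_C j.
have Lj : (legendre (psi_ j) (t *: p) <= (t * c + (1 - t) * C)%:E)%E.
  have /le_trans : (legendre (psi_ j) (t *: p) <= t%:E * legendre phi p + ((1 - t) * C)%:E)%E.
    by near: j; have [N _ HN] := upper `|p| t0 t1; exists N => // j /HN; exact.
  apply; rewrite EFinD; apply: leeD => //; rewrite EFinM.
  by apply: lee_wpmul2l => //; rewrite lee_fin ltW.
apply: le_trans ((legendre_le (psi_C j) _ _).1 Lj (x_ j)).
rewrite lee_fin dotZl.
have : dot x p - (t * (dot p x - c) + (1 - t) * - C - a) / t < dot (x_ j) p by near: j; exact: h2.
rewrite (dotC p (x_ j)) (dotC p x) ltrBlDr -ltrBlDl ltr_pdivlMr//.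
by lra.
Unshelve. all: by end_near. Qed.

Lemma lower_bound : exists C2 : R, \forall j \near \oo, forall x, ((- C2)%:E <= psi_ j x)%E.
Proof.
have [e [D [e0 hD]]] := legendre_bounded_near0 phiC.
have h2 : 0 < (2^-1 : R) by rewrite invr_gt0.
have h1 : (2^-1 : R) < 1 by rewrite invf_lt1// ltr1n.
exists (2^-1 * D + (1 - 2^-1) * C).
have [N _ HN] := upper 0 h2 h1; exists N => // j /HN /(_ 0).
rewrite normr0 lexx scaler0 => /(_ isT) h x.
have L0 : (legendre (psi_ j) 0 <= (2^-1 * D + (1 - 2^-1) * C)%:E)%E.
  apply: le_trans h _; rewrite EFinD; apply: leeD => //; rewrite EFinM.
  by apply: lee_wpmul2l; [rewrite lee_fin ltW|apply: hD; rewrite normr0 ltW].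
apply: le_trans ((legendre_le (psi_C j) _ _).1 L0 x).
by rewrite lee_fin -(scale0r 0) dotZl mul0r sub0r.
Qed.

(** The point z minimizes psi_ j z + k / 2 |z - x|^2 and p is the resulting
    subgradient k (x - z).  The bound [lower] at p, combined with the Fenchel-Young
    inequality for phi at x, gives psi_ j z + k |z - x|^2 < r + e1; the factor k is
    so large that this forces |z - x| <= e.  The bound can be used because p stays
    in a ball of radius B that is the same for all j. *)
Lemma epi_limsup (x : 'cV[R]_n) (r e : R) : phi x = r%:E -> 0 < e ->
  \forall j \near \oo, exists z, `|z - x| <= e /\ (psi_ j z <= (r + e)%:E)%E.
Proof.
move=> phix e0; have [C2 hC2] := lower_bound.
pose e1 := Num.min e 1.
have e1e : e1 <= e by rewrite /e1 ge_min lexx.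
have e11 : e1 <= 1 by rewrite /e1 ge_min lexx orbT.
have e10 : 0 < e1 by rewrite /e1 lt_min e0 ltr01.
pose k := (`|r| + `|C2| + 1) / e ^+ 2.
have nr := normr_ge0 r; have nC := normr_ge0 C2.
have k0 : 0 < k by rewrite divr_gt0 ?exprn_gt0//; lra.
pose al := n%:R * `|x| + C1; pose be := C1 + `|C2|.
have al0 : 0 <= al by rewrite addr_ge0// mulr_ge0.
have be0 : 0 <= be by rewrite addr_ge0.
pose B := 1 + k * (al + be).
have re : r < r + e1 by lra.
have [t [t0 t1 rt]] := convex_comb_gt (- C) re.
near=> j.
have hlow : forall y, ((- C2)%:E <= psi_ j y)%E by near: j.
have hj : forall q, `|q| <= B ->
    (legendre phi (t *: q) <= t%:E * legendre (psi_ j) q + ((1 - t) * C)%:E)%E.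
  by near: j; exact: lower.
have [z [a [za _ zsub]]] := prox (psi_C j) x k0.
have zsub' : forall w, ((dot (k *: (x - z)) w - (dot (k *: (x - z)) z - a))%:E <= psi_ j w)%E.
  by move=> w; apply: le_trans (zsub w); rewrite lee_fin dotBr; lra.
set p := k *: (x - z) in zsub'.
have Lp : (legendre (psi_ j) p <= (dot p z - a)%:E)%E by apply/(legendre_le (psi_C j)).
have aC2 : - C2 <= a by have := hlow z; rewrite za lee_fin.
have pxz : dot p z = dot p x - k * dot (x - z) (x - z).
  by rewrite /p !dotE; ring.
(* The minorant of the transform of psi_ j and its upper bound [Lp] at p give
   |p|^2 / k <= al |p| + be. *)
have pB : `|p| <= B.
  have pp : `|p| ^+ 2 / k <= k * dot (x - z) (x - z).
    rewrite ler_pdivrMr//; apply: le_trans (sqr_norm_le_dot p) _.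
    by rewrite /p dotZl dotZr [leRHS]mulrC.
  have := le_trans (minorant j p) Lp; rewrite lee_fin pxz => h.
  have pn := le_trans (ler_norm _) (norm_dot p x).
  have C2n : - a <= `|C2| by have := ler_norm C2; lra.
  have h' : `|p| ^+ 2 / k <= al * `|p| + be.
    by move: pn; rewrite /al /be; move: (n%:R : R) => n'; lra.
  move: h'; rewrite ler_pdivrMr// leNgt => h'; rewrite leNgt; apply: contra h'.
  rewrite /B; move: `|p| => P hP.
  (* Otherwise P = `|p| > 1 + k (al + be), so that
     P^2 > P + k al P + k be P >= k (al P + be). *)
  have ka : 0 <= k * al by rewrite mulr_ge0// ltW.
  have kb : 0 <= k * be by rewrite mulr_ge0// ltW.
  have P1 : 1 < P by lra.
  have g1 : 0 < P * (P - (1 + k * (al + be))) by rewrite mulr_gt0//; lra.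
  have g2 : 0 <= (P - 1) * (k * be) by rewrite mulr_ge0//; lra.
  by rewrite expr2; lra.
have key := hj _ pB.
have {}key : (legendre phi (t *: p) <= (t * (dot p z - a) + (1 - t) * C)%:E)%E.
  apply: le_trans key _; rewrite EFinD; apply: leeD => //; rewrite EFinM.
  by apply: lee_wpmul2l => //; rewrite lee_fin ltW.
have := (legendre_le phiC _ _).1 key x; rewrite phix lee_fin dotZl pxz => h.
have h' : a + k * dot (x - z) (x - z) < r + e1.
  by rewrite -(ltr_pM2l t0); lra.
have dz := dotxx_ge0 (x - z).
have kd := mulr_ge0 (ltW k0) dz.
exists z; split; last by rewrite za lee_fin; lra.
rewrite -normrN opprB -ler_sqr ?nnegrE ?(ltW e0)//.
apply: le_trans (sqr_norm_le_dot _) _; rewrite -(ler_pM2l k0) {2}/k.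
rewrite mulfVK ?expf_neq0 ?gt_eqF//.
by have := ler_norm r; have := ler_norm C2; lra.
Unshelve. all: by end_near. Qed.

Lemma epi_cvg_of_legendre : epi_cvg psi_ phi.
Proof.
move=> x; split=> [x_ xx|].
  by apply: limn_einf_ge => a; exact: epi_liminf.
have [phi_gt _ _ _ _] := phiC.
case E : (phi x) (phi_gt x) => [r| |] // _; last first.
  exists (fun=> x); first exact: cvg_cst.
  apply/cvgeyPge => A; apply: epi_liminf; first exact: cvg_cst.
  by rewrite E ltry.
(* Near-optimal points for the errors 1 / (m + 1), combined diagonally, form a
   recovery sequence. *)
pose e_ (m : nat) : R := m.+1%:R^-1.
have e_0 m : 0 < e_ m by rewrite invr_gt0.
have e_le m m' : (m <= m')%N -> e_ m' <= e_ m.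
  by move=> mm; rewrite lef_pV2 ?posrE// ler_nat ltnS.
have e_arch e : 0 < e -> exists m, e_ m <= e.
  move=> e0; exists (Num.bound e^-1); rewrite /e_ -[leRHS]invrK lef_pV2 ?posrE ?invr_gt0//.
  have /ltW/le_trans -> // : e^-1 < (Num.bound e^-1)%:R.
    by apply: archi_boundP; rewrite invr_ge0 ltW.
  by rewrite ler_nat.
have [z_ hz] := @diagonal_selection _ x
  (fun m j z => `|z - x| <= e_ m /\ (psi_ j z <= (r + e_ m)%:E)%E)
  (fun m => epi_limsup E (e_0 m)).
have hz' e : 0 < e -> \forall j \near \oo, `|z_ j - x| <= e /\ (psi_ j (z_ j) <= (r + e)%:E)%E.
  move=> /e_arch[m me]; have [N _ HN] := hz m; exists N => // j /HN[m' /e_le mm' [h1 h2]].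
  split; first by apply: le_trans h1 _; apply: le_trans me.
  by apply: le_trans h2 _; rewrite lee_fin lerD2l; apply: le_trans me.
have zx : z_ @ \oo --> x.
  apply/cvgrPdist_le => e /hz'[N _ HN]; exists N => // j /HN[+ _].
  by rewrite -normrN opprB.
exists z_ => //.
have lo e : 0 < e -> \forall j \near \oo, ((r - e)%:E <= psi_ j (z_ j))%E.
  by move=> e0; apply: (epi_liminf zx); rewrite E lte_fin; lra.
apply/fine_cvgP; split.
  have [N _ HN] := hz' _ ltr01; have [N' _ HN'] := lo _ ltr01.
  exists (maxn N N') => // j /=; rewrite geq_max => /andP[/HN[_ h1] /HN' h2].
  rewrite fin_numE; apply/andP; split.
    by rewrite gt_eqF// (lt_le_trans _ h2)// ltNyr.
  by rewrite lt_eqF// (le_lt_trans h1)// ltry.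
apply/cvgrPdist_le => e e0.
have [N _ HN] := hz' _ e0; have [N' _ HN'] := lo _ e0.
exists (maxn N N') => // j /=; rewrite geq_max => /andP[/HN[_ h1] /HN' h2].
move: h1 h2; case: (psi_ j (z_ j)) => [b| |] //=.
by rewrite !lee_fin ler_norml => h1 h2; apply/andP; split; lra.
Qed.

End EpiConvergence.

(** * The rotation mean *)

Section RotationMean.
Variables (R : realType) (n : nat).
Variable mu : probability (borelM R n) R.
Hypothesis muSO : mu (@SOgrp R n) = 1%E.
Variable psi : 'cV[R]_n -> \bar R.
Hypothesis psiC : Conv_c psi.

(** A^-1 (t p) is the convex combination of B^-1 p, with weight t, and of a vector w
    that is small when A is close to B. *)
Lemma legendre_perturb (e C : R) (A B : 'M[R]_n) (p : 'cV[R]_n) (t : R) :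
  (forall w, `|w| <= e -> (legendre psi w <= C%:E)%E) ->
  SOgrp A -> SOgrp B -> 0 < t -> t < 1 ->
  t * (n%:R * (`|A - B| * `|p|)) <= (1 - t) * e ->
  (legendre psi (invmx A *m (t *: p)) <=
     t%:E * legendre psi (invmx B *m p) + ((1 - t) * C)%:E)%E.
Proof.
move=> hC [oA _] [oB _] t0 t1 small; rewrite !Ogrp_invmx//.
have t1' : 0 < 1 - t by lra.
pose w := (t / (1 - t)) *: ((A^T - B^T) *m p).
have -> : A^T *m (t *: p) = t *: (B^T *m p) + (1 - t) *: w.
  rewrite /w scalerA mulrCA divff ?gt_eqF// mulr1 mulmxBl scalerBr addrC subrK.
  by rewrite scalemxAr.
apply: le_trans (legendre_convex psiC _ _ (ltW t0) (ltW t1)) _.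
rewrite EFinM; apply: leeD => //; apply: lee_wpmul2l; first by rewrite lee_fin ltW.
apply: hC; rewrite /w normrZ gtr0_norm ?divr_gt0//.
rewrite mulrAC ler_pdivrMr// [e * _]mulrC; apply: le_trans small.
rewrite ler_pM2l//; apply: le_trans (norm_mulmx _ _) _.
have -> : A^T - B^T = (A - B)^T by rewrite linearB.
by rewrite norm_trmx.
Qed.

(** On rotations the inverse is the transpose, and composing the lower
    semicontinuous transform with the continuous map A |-> A^T p gives a lower
    semicontinuous function on all matrices. *)
Lemma measurable_legendre_orbit (p : 'cV[R]_n) :
  measurable_fun (@SOgrp R n : set (borelM R n))
    (fun A : borelM R n => legendre psi (invmx (A : 'M[R]_n) *m p)).
Proof.
apply: (eq_measurable_fun (fun A : borelM R n => legendre psi ((A : 'M[R]_n)^T *m p))).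
  by move=> A; rewrite inE => -[oA _]; rewrite Ogrp_invmx.
apply: measurable_funTS.
have cont y : continuous (fun A : 'M[R]_n => dot (A^T *m p) y) by exact: continuous_dot_trmx.
exact: (lsc_measurable_borelM (legendre_lsc (psi := psi) cont)).
Qed.

Lemma legendre_orbit_minorant : exists2 C1 : R, 0 <= C1 &
  forall A p, SOgrp A -> ((- (C1 * (1 + `|p|)))%:E <= legendre psi (invmx A *m p))%E.
Proof.
have [z [a [za _]]] := Conv_c_minimizer psiC.
exists (n%:R * (n%:R * `|z|) + `|a|); first by rewrite !(addr_ge0, mulr_ge0).
move=> A p sA; have [oA _] := sA; rewrite Ogrp_invmx//.
apply: le_trans (fenchel_young psi z _); rewrite za -EFinB lee_fin.
have h1 : `|A^T *m p| <= n%:R * `|p|.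
  apply: le_trans (norm_mulmx _ _) _; rewrite ler_wpM2l// norm_trmx.
  rewrite ler_piMl//; apply: norm_coordP => // i j; exact: SOgrp_coord.
have h2 : - dot (A^T *m p) z <= n%:R * (n%:R * `|z|) * `|p|.
  apply: le_trans (ler_norm _) _; rewrite normrN; apply: le_trans (norm_dot _ _) _.
  have -> : n%:R * (n%:R * `|z|) * `|p| = n%:R * ((n%:R * `|p|) * `|z|) by ring.
  by rewrite ler_wpM2l// ler_wpM2r.
have h3 : 0 <= n%:R * (n%:R * `|z|) by rewrite !mulr_ge0.
have h4 := ler_norm a; have h5 : 0 <= `|a| * `|p| by rewrite mulr_ge0.
by lra.
Qed.

Variable Psi : ('cV[R]_n -> \bar R) -> \bar R.
Hypothesis PsiC : epi_convex Psi.
Hypothesis PsiSO : invariant_under (@SOgrp R n) Psi.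
Variable psi_rot : 'cV[R]_n -> \bar R.
Hypothesis rotE : is_rot mu psi psi_rot.

(** The epi-convex combination phi of rotated copies of psi along a partition of
    SO(n) of mesh delta.  Its transform and that of psi_rot are a Riemann sum and
    the integral of the same function, compared by [legendre_perturb]. *)
Lemma rotation_mean_approx (e C C1 delta : R) :
  (forall w, `|w| <= e -> (legendre psi w <= C%:E)%E) ->
  (forall A p, SOgrp A -> ((- (C1 * (1 + `|p|)))%:E <= legendre psi (invmx A *m p))%E) ->
  0 < delta ->
  exists phi, [/\ Conv_c phi, (Psi phi <= Psi psi)%E,
    forall p, ((- (C1 * (1 + `|p|)))%:E <= legendre phi p)%E &
    forall t p, 0 < t -> t < 1 -> t * (n%:R * (delta * `|p|)) <= (1 - t) * e ->
     (legendre phi (t *: p) <= t%:E * legendre psi_rot p + ((1 - t) * C)%:E)%E /\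
     (legendre psi_rot (t *: p) <= t%:E * legendre phi p + ((1 - t) * C)%:E)%E].
Proof.
move=> hC hC1 d0; have [_ rotL] := rotE.
have [I [w [theta [w0 w1 sO disc]]]] := discretization muSO d0.
have CI i : Conv_c (fun x => psi (invmx (theta i) *m x)).
  by apply: Conv_c_Ogrp => //; have [] := sO i.
have MI i : (Psi (fun x => psi (invmx (theta i) *m x)) <= Psi psi)%E by rewrite PsiSO.
have [phi Cphi [Mphi Lphi]] := finite_jensen_fintype PsiC CI MI w0 w1.
have LphiE p : (legendre phi p = \sum_i (w i)%:E * legendre psi (invmx (theta i) *m p))%E.
  by rewrite Lphi; apply: eq_bigr => i _; rewrite legendre_Ogrp//; have [] := sO i.
exists phi; split => // [p|t p t0 t1 small].
  rewrite LphiE.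
  have -> : (- (C1 * (1 + `|p|)))%:E = (\sum_i (w i)%:E * (- (C1 * (1 + `|p|)))%:E)%E.
    by under eq_bigr do rewrite -EFinM; rewrite sumEFin -mulr_suml w1 mul1r.
  by apply: lee_sum => i _; apply: lee_wpmul2l; [rewrite lee_fin|exact: hC1].
have pert A B : SOgrp A -> SOgrp B -> `|A - B| <= delta ->
    (legendre psi (invmx A *m (t *: p)) <=
     t%:E * legendre psi (invmx B *m p) + ((1 - t) * C)%:E)%E.
  move=> sA sB AB; apply: (legendre_perturb hC) => //.
  apply: le_trans small; rewrite ler_pM2l// ler_wpM2l// ler_wpM2r//.
have Lgt q := legendre_gtNy psiC q.
split; last first.
  rewrite rotL LphiE -affine_sume ?(ltW t0)//.
  apply: (disc _ _ (measurable_legendre_orbit _) _).1 => [i|i eta sE hE].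
    case: (legendre psi _) (Lgt (invmx (theta i) *m p)) => [b| |] // _.
      by rewrite -EFinM -EFinD ltNyr.
    by rewrite gt0_muley ?lte_fin// addye.
  exact: pert.
rewrite rotL LphiE.
(* Solve f (theta_i^-1 (t p)) = t a_i + (1 - t) C for a_i, which then minorizes
   the integrand f (eta^-1 p) on the i-th cell. *)
pose a i := ((t^-1)%:E * (legendre psi (invmx (theta i) *m (t *: p)) - ((1 - t) * C)%:E))%E.
have t0' : 0 < t^-1 by rewrite invr_gt0.
have aE i : legendre psi (invmx (theta i) *m (t *: p)) =
    (t%:E * a i + ((1 - t) * C)%:E)%E.
  by rewrite /a muleA -EFinM divff ?gt_eqF// mul1e subeK.
under eq_bigr do rewrite aE.
rewrite affine_sume ?(ltW t0)//; apply: leeD => //; apply: lee_wpmul2l.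
  by rewrite lee_fin ltW.
apply: (disc _ _ (measurable_legendre_orbit _) _).2 => [i|i eta sE hE].
  rewrite /a; case: (legendre psi _) (Lgt (invmx (theta i) *m (t *: p))) => [b| |] // _.
    by rewrite -EFinB -EFinM ltNyr.
  by rewrite gt0_muley ?lte_fin.
rewrite /a -(@lee_pmul2l _ t%:E) ?lte_fin// muleA -EFinM divff ?gt_eqF// mul1e.
by rewrite leeBlDr//; apply: pert => //; rewrite -normrN opprB.
Qed.

(** The approximations of mesh 1 / (j + 1) epi-converge to psi_rot, and Psi is at most
    Psi psi on all of them. *)
Lemma rotation_mean_le : epi_lsc Psi -> (Psi psi_rot <= Psi psi)%E.
Proof.
move=> lPsi; have [rotC _] := rotE.
have [e [C [e0 hC]]] := legendre_bounded_near0 psiC.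
have [C1 C1_ge0 hC1] := legendre_orbit_minorant.
pose d_ (j : nat) : R := j.+1%:R^-1.
have d0 j : 0 < d_ j by rewrite invr_gt0.
have /choice[psi_ hpsi] := fun j => rotation_mean_approx hC hC1 (d0 j).
have small B t : 0 < t -> t < 1 -> \forall j \near \oo, forall p : 'cV[R]_n,
    `|p| <= B -> t * (n%:R * (d_ j * `|p|)) <= (1 - t) * e.
  move=> t0 t1; pose K := t * n%:R * `|B| / ((1 - t) * e).
  have D0 : 0 < (1 - t) * e by rewrite mulr_gt0//; lra.
  have K0 : 0 <= K by rewrite divr_ge0 ?(ltW D0)// !mulr_ge0// ltW.
  exists (Num.bound K) => // j /= Kj p pB.
  have Kj' : K <= j.+1%:R.
    by apply: le_trans (ltW (archi_boundP K0)) _; rewrite ler_nat ltnW.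
  have -> : t * (n%:R * (d_ j * `|p|)) = (t * n%:R * `|p|) / j.+1%:R by rewrite /d_; ring.
  rewrite ler_pdivrMr// [leRHS]mulrC -ler_pdivrMr//; apply: le_trans Kj'.
  rewrite ler_pM2r ?invr_gt0// ler_wpM2l ?mulr_ge0 ?(ltW t0)//.
  exact: le_trans pB (ler_norm _).
have psi_C j : Conv_c (psi_ j) by have [] := hpsi j.
have : epi_cvg psi_ psi_rot.
  apply: (@epi_cvg_of_legendre _ _ _ _ C C1) => // [B t t0 t1|B t t0 t1|j p].
  - have [N _ HN] := small B t t0 t1; exists N => // j /HN h p /h.
    by have [_ _ _ H] := hpsi j; move=> /(H _ _ t0 t1)[].
  - have [N _ HN] := small B t t0 t1; exists N => // j /HN h p /h.
    by have [_ _ _ H] := hpsi j; move=> /(H _ _ t0 t1)[].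
  - by have [] := hpsi j.
move=> /(lPsi _ _ psi_C rotC)/le_trans; apply.
rewrite limn_einf_lim (cvg_lim _ (@cvg_einfs_sup _ _))//.
apply: ge_ereal_sup => _ [j _ <-]; apply: (@le_trans _ _ (Psi (psi_ j))).
  by apply: ereal_inf_lbound; exists j => /=.
by have [] := hpsi j.
Qed.

End RotationMean.

Theorem theorem2p1 (R : realType) :
  (forall (n : nat) (mu : probability (borelM R n) R)
          (Psi : ('cV[R]_n -> \bar R) -> \bar R),
     (2 <= n)%N -> haar_SO mu ->
     one_sided_infinite Psi -> epi_lsc Psi -> epi_convex Psi ->
     invariant_under (@SOgrp R n) Psi ->
     forall psi psi_rot : 'cV[R]_n -> \bar R,
       Conv_c psi -> is_rot mu psi psi_rot -> (Psi psi >= Psi psi_rot)%E) /\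
  (forall Psi : ('cV[R]_1 -> \bar R) -> \bar R,
     one_sided_infinite Psi -> epi_convex Psi ->
     invariant_under (@Ogrp R 1) Psi ->
     forall psi : 'cV[R]_1 -> \bar R,
       Conv_c psi -> (Psi psi >= Psi (rot1 psi))%E).
Proof.
split=> [n mu Psi _ [muSO _] _ lPsi cPsi iPsi psi psi_rot psiC rotE|Psi _ cPsi iPsi psi psiC].
  exact: (rotation_mean_le muSO psiC cPsi iPsi rotE lPsi).
exact: one_dimensional_case.
Qed.
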